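(* Let $F:\mathbb{R}^n\rightrightarrows\mathbb{R}^n$ be a multifunction satisfying condition $(U)$ (stated in the context). Let $\Psi:\mathbb{R}^n\to(-\infty,+\infty)$ be lower semicontinuous, and set $\mathcal{S}=\{x\in\mathbb{R}^n:\Psi(x)\le 0\}$. If there exists an open set $\mathcal{U}\subseteq\mathbb{R}^n$ containing $\mathcal{S}$ such that $H_F(x,\partial_P\Psi(x))\le 0$ for all $x\in\mathcal{U}$, then $(F,\mathcal{S})$ is strongly invariant in $\mathbb{R}^n$.
   Context: Notation. $\|\cdot\|$ is the Euclidean norm on $\mathbb{R}^n$, and $\langle\cdot,\cdot\rangle$ the Euclidean inner product. For $p\in\mathbb{R}^n$, $\mathcal{B}_n(p)=\{x\in\mathbb{R}^n:\|x-p\|\le 1\}$, and $\gamma\mathcal{B}_n(p)$ denotes the closed ball of radius $\gamma>0$ centered at $p$. For $D\subseteq\mathbb{R}^n$, $\mathrm{cone}\{D\}=\bigcup_{\eta\ge 0}\eta D$. ''A.a.'' means Lebesgue almost all. Trajectories. A trajectory of $F$ on $[0,T]$ starting at $x_o$ is an absolutely continuous function $\phi:[0,T]\to\mathbb{R}^n$ with $\phi(0)=x_o$ and $\dot\phi(t)\in F(\phi(t))$ for a.a. $t\in[0,T]$. $\mathrm{Traj}_T(F,x)$ is the set of all trajectories $\phi:[0,T]\to\mathbb{R}^n$ of $F$ starting at $x$. The class $\mathcal{C}[0,T]$. A modulus is a nondecreasing continuous function $\omega:[0,\infty)\to[0,\infty)$ with $\omega(0)=0$. For $T\ge 0$, $\mathcal{C}[0,T]$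 is the set of all functions $f:[0,T]\times\mathbb{R}^n\to\mathbb{R}^n$ such that: (1) for each $x\in\mathbb{R}^n$ the map $t\mapsto f(t,x)$ is measurable; (2) for each compact $K\subseteq\mathbb{R}^n$ there is a modulus $\omega_{f,K}$ such that $\|f(t,x_1)-f(t,x_2)\|\le\omega_{f,K}(\|x_1-x_2\|)$ for all $t\in[0,T]$ and $x_1,x_2\in K$; (3) $f$ has linear growth on $[0,T]$, i.e. there exist positive constants $c_1,c_2$ with $\|f(t,x)\|\le c_1+c_2\|x\|$ for all $t\in[0,T]$, $x\in\mathbb{R}^n$. For $\bar x\in\mathbb{R}^n$, $\mathcal{C}_F([0,T],\bar x)$ is the set of all $f\in\mathcal{C}[0,T]$ for which there exists $\gamma>0$ such that $f(t,x)\in\mathrm{cone}\{F(x)\}$ for a.a. $t\in[0,T]$ and all $x\in\gamma\mathcal{B}_n(\bar x)$. Condition $(U)$: for each $\bar x\in\mathbb{R}^n$, each $T\ge 0$, and each $\phi\in\mathrm{Traj}_T(F,\bar x)$, there exists $f\in\mathcal{C}_F([0,T],\bar x)$ for which $\phi$ is the unique solution of the initial value problem $\dot y(t)=f(t,y(t))$, $y(0)=\bar x$ on $[0,T]$. Hamiltonian. $H_F(x,p)=\sup_{v\in F(x)}\langle v,p\rangle\in[-\infty,+\infty]$. For $D\subseteq\mathbb{R}^n$, $H_F(x,D)\le 0$ means $H_F(x,d)\le 0$ for all $d\in D$; it holds vacuously if $D=\emptyset$. Proximal subgradients. $\zeta\in\partial_P\Psi(x)$ means there exist $\sigma>0$ and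 $\eta>0$ such that $\Psi(x')\ge\Psi(x)+\langle\zeta,x'-x\rangle-\sigma\|x'-x\|^2$ for all $x'\in\eta\mathcal{B}_n(x)$. This set may be empty. Strong invariance in $\mathbb{R}^n$. For $x_0\in\mathbb{R}^n$ let $\Upsilon(x_0)$ be the set of functions $x(\cdot):[0,T)\to\mathbb{R}^n$, $0<T\le\infty$, absolutely continuous on every compact subinterval of $[0,T)$, with $x(0)=x_0$, $\dot x(t)\in F(x(t))$ for a.a. $t\in[0,T)$, and such that either $T=\infty$ or $\|x(t)\|\to\infty$ as $t\uparrow T$ (that is, $T$ is an escape time of $x(\cdot)$ from $\mathbb{R}^n$). For a closed set $E\subseteq\mathbb{R}^n$, $(F,E)$ is strongly invariant in $\mathbb{R}^n$ if for every $x_0\in E$, every $x(\cdot)\in\Upsilon(x_0)$, with domain $[0,T)$, satisfies $x(t)\in E$ for all $t\in[0,T)$. *)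

(* Defs.v *)
(* The space R^n is 'rV[R]_n: its topology is the library's
   (that of the sup norm), while every norm, ball and inner product below is
   Euclidean.  A function on [0, T] or [0, T) is a total function on R of which
   only the values on that interval matter. *)
From HB Require Import structures.
From mathcomp Require Import all_boot all_order all_algebra.
From mathcomp Require Import all_classical all_reals all_analysis.
From mathcomp Require Import measurable_realfun.

Set Implicit Arguments.
Unset Strict Implicit.
Unset Printing Implicit Defensive.

Import Order.TTheory GRing.Theory Num.Theory.
Import numFieldNormedType.Exports.

Local Open Scope classical_set_scope.
Local Open Scope ring_scope.

Section Euclidean.
Context {R : realType} {n : nat}.
Implicit Types (x y : 'rV[R]_n) (D : set 'rV[R]_n).

Definition dot x y : R := \sum_(i < n) x 0 i * y 0 i.

Definition enorm x : R := Num.sqrt (dot x x).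

Definition eball x (r : R) : set 'rV[R]_n := [set y | enorm (y - x) <= r].

Definition cone D : set 'rV[R]_n :=
  \bigcup_(eta in [set eta : R | 0 <= eta]) [set eta *: v | v in D].

End Euclidean.

Section Trajectories.
Context {R : realType} {n : nat}.
Implicit Types (F : 'rV[R]_n -> set 'rV[R]_n) (phi : R -> 'rV[R]_n).

Definition abs_continuous (a b : R) phi : Prop :=
  forall e : R, 0 < e -> exists2 d : R, 0 < d &
    forall (m : nat) (s t : 'I_m -> R),
      (forall i, a <= s i /\ s i <= t i /\ t i <= b) ->
      (forall i j, i != j -> t i <= s j \/ t j <= s i) ->
      \sum_(i < m) (t i - s i) < d ->
      \sum_(i < m) enorm (phi (t i) - phi (s i)) < e.

(* [is_derive] is a two-sided derivative; the endpoints 0 and T, where it could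
   see values of phi outside [0, T], are Lebesgue negligible. *)
Definition Traj F (T : R) (x0 : 'rV[R]_n) : set (R -> 'rV[R]_n) :=
  [set phi | [/\ abs_continuous 0 T phi,
                 phi 0 = x0
               & {ae @lebesgue_measure R, forall t, 0 <= t <= T ->
                   exists2 v, F (phi t) v & is_derive t 1 phi v}]].

Definition ivp_solution (f : R -> 'rV[R]_n -> 'rV[R]_n) (T : R)
    (x0 : 'rV[R]_n) : set (R -> 'rV[R]_n) :=
  [set y | [/\ abs_continuous 0 T y,
               y 0 = x0
             & {ae @lebesgue_measure R, forall t, 0 <= t <= T ->
                 is_derive t 1 y (f t (y t))}]].

Definition unique_ivp_solution f T x0 phi : Prop :=
  ivp_solution f T x0 phi /\
  forall y, ivp_solution f T x0 y -> forall t, 0 <= t <= T -> y t = phi t.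

End Trajectories.

Section ClassC.
Context {R : realType} {n : nat}.

Definition modulus (w : R -> R) : Prop :=
  [/\ forall r : R, 0 <= r -> 0 <= w r,
      forall r s : R, 0 <= r -> r <= s -> w r <= w s,
      {within [set r : R | 0 <= r], continuous w}
    & w 0 = 0].

(* Lebesgue (rather than Borel) measurability on the domain side: the
   sigma-algebra is the Lebesgue completion of the Borel sets of R.  The
   codomain R^n carries its Borel sigma-algebra. *)
Definition lebesgue_measurable_fun (D : set R) (g : R -> 'rV[R]_n) : Prop :=
  @measurable_fun _ _
    (g_sigma_algebraType (completed_algebra_gen (@lebesgue_measure R)))
    (g_sigma_algebraType (@open 'rV[R]_n)) D g.

Definition classC (T : R) : set (R -> 'rV[R]_n -> 'rV[R]_n) :=
  [set f |
    [/\ forall x, lebesgue_measurable_fun `[0, T] (f ^~ x),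
        forall K : set 'rV[R]_n, compact K ->
          exists2 w : R -> R, modulus w &
            forall t x1 x2, 0 <= t <= T -> K x1 -> K x2 ->
              enorm (f t x1 - f t x2) <= w (enorm (x1 - x2))
      & exists c1 c2 : R, [/\ 0 < c1, 0 < c2 &
          forall t x, 0 <= t <= T -> enorm (f t x) <= c1 + c2 * enorm x]]].

(* The exceptional null set of times does not depend on x. *)
Definition classCF (F : 'rV[R]_n -> set 'rV[R]_n) (T : R) (xbar : 'rV[R]_n) :
    set (R -> 'rV[R]_n -> 'rV[R]_n) :=
  [set f | classC T f /\
    exists2 gamma : R, 0 < gamma &
      {ae @lebesgue_measure R, forall t, 0 <= t <= T ->
        forall x, eball xbar gamma x -> cone (F x) (f t x)}].

Definition conditionU (F : 'rV[R]_n -> set 'rV[R]_n) : Prop :=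
  forall (xbar : 'rV[R]_n) (T : R), 0 <= T ->
  forall phi, Traj F T xbar phi ->
  exists2 f, classCF F T xbar f & unique_ivp_solution f T xbar phi.

End ClassC.

Section Hamiltonian.
Context {R : realType} {n : nat}.

(* Equal to -oo when F x is empty. *)
Definition hamiltonian (F : 'rV[R]_n -> set 'rV[R]_n) (x p : 'rV[R]_n) :
    \bar R :=
  ereal_sup [set (dot v p)%:E | v in F x].

Definition hamiltonian_le0 (F : 'rV[R]_n -> set 'rV[R]_n) (x : 'rV[R]_n)
    (D : set 'rV[R]_n) : Prop :=
  forall d, D d -> (hamiltonian F x d <= 0)%E.

Definition prox_subdiff (Psi : 'rV[R]_n -> R) (x : 'rV[R]_n) :
    set 'rV[R]_n :=
  [set zeta | exists sigma eta : R, [/\ 0 < sigma, 0 < eta &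
    forall x', eball x eta x' ->
      Psi x + dot zeta (x' - x) - sigma * enorm (x' - x) ^+ 2 <= Psi x']].

End Hamiltonian.

Section Invariance.
Context {R : realType} {n : nat}.

(* Pairs (T, x) where [0, T[ is the domain of x and T may be +oo. *)
Definition maximal_traj (F : 'rV[R]_n -> set 'rV[R]_n) (x0 : 'rV[R]_n)
    (T : \bar R) (x : R -> 'rV[R]_n) : Prop :=
  [/\ (0 < T)%E,
      forall a b : R, 0 <= a -> a <= b -> (b%:E < T)%E ->
        abs_continuous a b x,
      x 0 = x0,
      {ae @lebesgue_measure R, forall t : R, 0 <= t -> (t%:E < T)%E ->
        exists2 v, F (x t) v & is_derive t 1 x v}
    & T = +oo%E \/
      exists2 r : R, T = r%:E & enorm (x t) @[t --> r^'-] --> +oo].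

Definition strongly_invariant (F : 'rV[R]_n -> set 'rV[R]_n)
    (E : set 'rV[R]_n) : Prop :=
  forall x0, E x0 ->
  forall (T : \bar R) (x : R -> 'rV[R]_n), maximal_traj F x0 T x ->
  forall t : R, 0 <= t -> (t%:E < T)%E -> E (x t).

End Invariance.

(* Main.v *)
(* Along a trajectory issued from [xbar], condition (U) provides a field [f] in
   the cones of [F] near [xbar], whose initial value problem has the trajectory
   as only solution.  It thus suffices to find one solution along which [Psi]
   stays at most [Psi xbar] for a short time.  It is a limit of Euler polygons
   in which the increment from a node [x] is the integral of [f (s, z) ds] for
   the point [z] that minimizes [Psi z + lam |z - x|^2] over a ball.  Then
   [2 lam (x - z)] is a proximal subgradient of [Psi] at [z], so the Hamiltonian
   condition makes the Moreau envelope of [Psi] increase by at most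
   [O(lam h^2)] per step of length [h]; letting [lam] tend to infinity and
   [lam h] to 0, [z - x] tends to 0 and [limsup Psi z <= Psi xbar].
   Freezing [z] on each step is what allows [f] to be merely measurable in time,
   and working with the envelope avoids horizontal normals to the epigraph. *)
Require Import Defs.
From mathcomp Require Import all_boot all_order all_algebra.
From mathcomp Require Import all_classical all_reals all_analysis.
From mathcomp Require Import measurable_realfun.
From mathcomp Require Import ring lra.

Import Order.TTheory GRing.Theory Num.Theory.
Import numFieldNormedType.Exports.

Local Open Scope classical_set_scope.
Local Open Scope ring_scope.

Set Implicit Arguments.
Unset Strict Implicit.
Unset Printing Implicit Defensive.

(** * Euclidean norm and lower semicontinuity *)

Section EuclideanTheory.
Context {R : realType} {n : nat}.
Implicit Types (x y z : 'rV[R]_n) (a : R).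

Lemma dotC x y : dot x y = dot y x.
Proof. by apply: eq_bigr => i _; rewrite mulrC. Qed.

Lemma dotDl x y z : dot (x + y) z = dot x z + dot y z.
Proof. by rewrite -big_split; apply: eq_bigr => i _; rewrite mxE mulrDl. Qed.

Lemma dotZl a x y : dot (a *: x) y = a * dot x y.
Proof. by rewrite big_distrr; apply: eq_bigr => i _; rewrite mxE -mulrA. Qed.

Lemma dotNl x y : dot (- x) y = - dot x y.
Proof. by rewrite -scaleN1r dotZl mulN1r. Qed.

Lemma dotDr x y z : dot x (y + z) = dot x y + dot x z.
Proof. by rewrite !(dotC x) dotDl. Qed.

Lemma dotNr x y : dot x (- y) = - dot x y.
Proof. by rewrite !(dotC x) dotNl. Qed.

Lemma dot00 : dot (0 : 'rV[R]_n) 0 = 0.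
Proof. by rewrite -(scale0r 0) dotZl mul0r. Qed.

Lemma dot_ge0 x : 0 <= dot x x.
Proof. by apply: sumr_ge0 => i _; rewrite -expr2 sqr_ge0. Qed.

Lemma enorm_ge0 x : 0 <= enorm x.
Proof. exact: sqrtr_ge0. Qed.

Lemma sqr_enorm x : enorm x ^+ 2 = dot x x.
Proof. by rewrite sqr_sqrtr// dot_ge0. Qed.

Lemma dotDD_le x y : dot (x + y) (x + y) <= 2 * dot x x + 2 * dot y y.
Proof.
have := dot_ge0 (x - y); rewrite !(dotDl, dotDr, dotNl, dotNr) (dotC y x).
lra.
Qed.

Lemma normr_coord_le x (i : 'I_n) : `|x 0 i| <= `|x|.
Proof.
rewrite [leRHS]/Num.norm /= mx_normrE; apply/bigmax_geP; right => /=.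
by exists (0, i).
Qed.

Lemma normr_row_le x a : 0 <= a -> (forall i, `|x 0 i| <= a) -> `|x| <= a.
Proof.
move=> a0 xa; rewrite [leLHS]/Num.norm /= mx_normrE.
apply/bigmax_leP; split => //.
by move=> [i j] _ /=; rewrite (ord1 i).
Qed.

Lemma normr_le_enorm x : `|x| <= enorm x.
Proof.
apply: normr_row_le (enorm_ge0 x) _ => i.
rewrite -sqrtr_sqr ler_wsqrtr// /dot (bigD1 i)//= -expr2 lerDl.
by apply: sumr_ge0 => j _; rewrite -expr2 sqr_ge0.
Qed.

Lemma dot_le_normr x : dot x x <= n%:R * `|x| ^+ 2.
Proof.
apply: (@le_trans _ _ (\sum_(i < n) `|x| ^+ 2)).
  apply: ler_sum => i _; rewrite -expr2 -[leLHS]real_normK ?num_real//.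
  by rewrite lerXn2r// ?nnegrE// normr_coord_le.
by rewrite sumr_const card_ord mulr_natl.
Qed.

Lemma enorm_le_normr x : enorm x <= n.+1%:R * `|x|.
Proof.
rewrite -[leRHS]ger0_norm ?mulr_ge0// -sqrtr_sqr ler_wsqrtr//.
apply: (le_trans (dot_le_normr x)); rewrite exprMn ler_wpM2r ?sqr_ge0//.
by rewrite -natrX ler_nat (leq_trans (leqnSn n))// expnS expn1 leq_pmulr.
Qed.

Lemma continuous_dot_self y : continuous (fun x => dot (x - y) (x - y)).
Proof.
move=> x; apply: (@cvg_big _ _ _ _ _ _ _ (nbhs x)) => [|i _].
  exact: add_continuous.
have c : (z - y) 0 i @[z --> x] --> (x - y) 0 i.
  rewrite (_ : (fun z => _) = fun z => z 0 i - y 0 i); last first.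
    by apply/funext => z; rewrite !mxE.
  rewrite [X in _ --> X](_ : _ = x 0 i - y 0 i) ?mxE//.
  apply: (@cvgB _ _ _ (nbhs x) _ (fun z : 'rV_n => z 0 i) (cst (y 0 i))).
    exact: coord_continuous.
  exact: cvg_cst.
exact: cvgM.
Qed.

End EuclideanTheory.

(** * Lower semicontinuous functions on compact sets *)

Section LscMin.
Context {R : realType} {T : ptopologicalType}.

Lemma lsc_open_gt (g : T -> R) (a : R) :
  lower_semicontinuous (fun x => (g x)%:E) -> open [set x | a < g x].
Proof.
by move=> /lower_semicontinuousP/(_ a).
Qed.

Lemma lscD_continuous (g q : T -> R) :
  lower_semicontinuous (fun x => (g x)%:E) -> continuous q ->
  lower_semicontinuous (fun x => (g x + q x)%:E).
Proof.
move=> glsc qc x a; rewrite lte_fin => agq.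
pose e := (g x + q x - a) / 2; have e0 : 0 < e by rewrite /e; lra.
have ng : \forall y \near x, g x - e < g y.
  by apply: open_nbhs_nbhs; split; [exact: lsc_open_gt|rewrite /=; lra].
have nq : \forall y \near x, `|q x - q y| < e.
  by have /cvgr_dist_lt := qc x; apply.
exists [set y | a < g y + q y]; last by move=> y /=; rewrite lte_fin.
near=> y; have h1 : g x - e < g y by near: y.
have : `|q x - q y| < e by near: y.
by rewrite ltr_norml /e in h1 * => /andP[h2 h3] /=; lra.
Unshelve. all: by end_near. Qed.

(** Without a minimum, the open sets where [g] exceeds [g y], for [y] in [A], cover [A]. In a finite
    subcover, the index [y0] with the smallest value lies in none of the sets. *)
Lemma lsc_min_compact (g : T -> R) (A : set T) :
  lower_semicontinuous (fun x => (g x)%:E) -> compact A -> A !=set0 ->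
  exists2 x, A x & forall y, A y -> g x <= g y.
Proof.
move=> glsc; rewrite compact_cover => cA [a0 Aa0]; apply: contrapT => nmin.
have lt_ex x : A x -> exists2 y, A y & g y < g x.
  move=> Ax; apply: contrapT => nlt; apply: nmin; exists x => // y Ay.
  by rewrite leNgt; apply/negP => ltg; apply: nlt; exists y.
have [||D DA Acov] := cA _ A (fun y => [set x | g y < g x]).
- by move=> y Ay; exact: lsc_open_gt.
- by move=> x /lt_ex[y Ay yx]; exists y.
have [y0 y0D y0min] : exists2 y0, y0 \in finmap.enum_fset D &
    forall y, y \in finmap.enum_fset D -> g y0 <= g y.
  have [z zD _] := Acov a0 Aa0; have {}zD : z \in finmap.enum_fset D by [].
  move: (finmap.enum_fset D) zD => s zs.
  have zi : (index z s < size s)%N by rewrite index_mem.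
  have [j _ jmin] := arg_minP (fun k : 'I_(size s) => g (nth z s k))
    (erefl : predT (Ordinal zi)).
  exists (nth z s j); first exact: mem_nth.
  move=> y ys; have yi : (index y s < size s)%N by rewrite index_mem.
  by have := jmin (Ordinal yi) isT; rewrite /= nth_index.
have Ay0 : A y0 by have := DA _ y0D; rewrite inE.
have [w wD] := Acov y0 Ay0; rewrite /= ltNge => /negP; apply; exact: y0min.
Qed.

End LscMin.

(** * Proximal points *)

Section ProximalPoints.
Context {R : realType} {n : nat}.
Variables (Psi : 'rV[R]_n -> R) (xbar : 'rV[R]_n) (r : R).
Hypothesis Psi_lsc : lower_semicontinuous (fun x => (Psi x)%:E).
Hypothesis r_gt0 : 0 < r.
Implicit Types (x y z w : 'rV[R]_n) (lam : R).

(** The squared form lets membership be checked by expanding [dot], without square roots. *)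
Lemma eballE x a y : 0 <= a ->
  eball x a y = (dot (y - x) (y - x) <= a ^+ 2) :> Prop.
Proof.
move=> a0; apply/propext; rewrite /eball /= -sqr_enorm; split => h.
  by rewrite lerXn2r ?nnegrE ?enorm_ge0.
by rewrite -(@ler_pXn2r _ 2)// nnegrE enorm_ge0.
Qed.

Lemma eball_center x a : 0 <= a -> eball x a x.
Proof. by move=> a0; rewrite eballE// subrr dot00 sqr_ge0. Qed.

Lemma compact_eball x a : 0 <= a -> compact (eball x a).
Proof.
move=> a0; apply: bounded_closed_compact.
  exists (`|x| + a); split; first exact: num_real.
  move=> M xaM y /= yx; apply: ltW; apply: le_lt_trans xaM.
  rewrite -{1}(subrK x y) addrC (le_trans (ler_normD _ _))// lerD2l.
  exact: le_trans (normr_le_enorm _) yx.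
rewrite (_ : eball x a =
  (fun y => dot (y - x) (y - x)) @^-1` [set t | t <= a ^+ 2]).
  by apply: closed_comp (@closed_le _ _) => y _; exact: continuous_dot_self.
by apply/seteqP; split => y; rewrite eballE.
Qed.

(** Proximal points of [Psi] restricted to the ball around [xbar]: compactness of the ball gives
    existence without any growth condition on [Psi]. A relation is used because minimizers may not
    be unique. *)
Definition is_prox lam x y := eball xbar r y /\ forall z, eball xbar r z ->
  Psi y + lam * dot (y - x) (y - x) <= Psi z + lam * dot (z - x) (z - x).

Lemma is_prox_ex lam x : exists y, is_prox lam x y.
Proof.
have qc : continuous (fun y => lam * dot (y - x) (y - x)).
  move=> y; apply: (@cvgM _ _ (nbhs y) _ (cst lam)); first exact: cvg_cst.
  exact: continuous_dot_self.
have [|y By ymin] := lsc_min_compact (lscD_continuous Psi_lsc qc)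
  (@compact_eball xbar r (ltW r_gt0)).
  by exists xbar; exact: eball_center (ltW r_gt0).
by exists y.
Qed.

(** Expanding the minimality of [y] around [y] gives the proximal inequality with [sigma = lam].
    With [y] in the half ball, all points within [r / 2] of [y] are admissible competitors. *)
Lemma is_prox_subgrad lam x y : 0 < lam -> is_prox lam x y ->
  dot (y - xbar) (y - xbar) <= (r / 2) ^+ 2 ->
  prox_subdiff Psi y ((2 * lam) *: (x - y)).
Proof.
move=> lam0 [_ ymin] yint; exists lam, (r / 2); split => //.
  by rewrite divr_gt0.
have r20 : 0 <= r / 2 by rewrite divr_ge0// ltW.
move=> z; rewrite eballE// => zy.
have /ymin : eball xbar r z.
  rewrite eballE ?(ltW r_gt0)// -[z](subrK y) -addrA.
  rewrite (le_trans (dotDD_le _ _))//.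
  by move: zy yint; rewrite expr_div_n; lra.
rewrite sqr_enorm.
have -> : z - x = (z - y) - (x - y) by rewrite opprB addrA subrK.
have -> : y - x = - (x - y) by rewrite opprB.
move: (z - y) (x - y) => w u.
rewrite !(dotDl, dotDr, dotNl, dotNr, dotZl) (dotC u w); lra.
Qed.

(* The Moreau envelope [min_z Psi z + lam |z - x|^2] is semiconcave, with
   supergradient [2 lam (x - y)] at [x]: this is its one-sided Taylor bound. *)
Lemma is_prox_descent lam x w y y' : 0 <= lam ->
  is_prox lam x y -> is_prox lam (x + w) y' -> dot (x - y) w <= 0 ->
  Psi y' + lam * dot (y' - (x + w)) (y' - (x + w)) <=
  Psi y + lam * dot (y - x) (y - x) + lam * dot w w.
Proof.
move=> lam0 [By _] [_ /(_ _ By) h] xyw; apply: le_trans h _.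
have -> : y - (x + w) = - (x - y) - w by rewrite opprB opprD addrA.
have -> : y - x = - (x - y) by rewrite opprB.
have : lam * dot (x - y) w <= 0 by rewrite mulr_ge0_le0.
move: (x - y) => u; rewrite !(dotDl, dotDr, dotNl, dotNr) (dotC w u); lra.
Qed.

(** The competitor is [xbar], and the inequality is divided by [lam]. *)
Lemma dot_is_prox_le lam m x y : 0 < lam -> is_prox lam x y -> m <= Psi y ->
  dot (y - x) (y - x) <= (Psi xbar - m) / lam + dot (xbar - x) (xbar - x).
Proof.
move=> lam0 [_ /(_ xbar)] ymin my; rewrite -(ler_pM2l lam0) mulrDr mulrC.
rewrite [lam * (_ / _)]mulrC divfK ?gt_eqF// mulrC.
have /ymin := eball_center xbar (ltW r_gt0); lra.
Qed.

End ProximalPoints.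

(** * Limits of Euler polygons *)

Section UltrafilterLimit.
Context {R : realType} {n : nat}.
Implicit Types (Y : nat -> R -> 'rV[R]_n) (D : set R).

Lemma compact_normr_le (rho : R) : compact [set x : 'rV[R]_n | `|x| <= rho].
Proof.
apply: bounded_closed_compact.
  exists rho; split; first exact: num_real.
  by move=> M rM x /le_trans; apply; exact: ltW.
rewrite (_ : mkset _ = (fun x => `|x|) @^-1` [set t | t <= rho])//.
by apply: closed_comp (@closed_le _ _) => y _; exact: norm_continuous.
Qed.

(* A limit along an ultrafilter replaces the extraction of a subsequence. *)
Lemma ultrafilter_limit Y D (rho : R) :
  (forall k t, D t -> `|Y k t| <= rho) ->
  exists y : R -> 'rV[R]_n,
    forall a b c (e : R) (P : set nat), D a -> D b -> D c -> 0 < e ->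
    (\forall k \near \oo, P k) ->
    exists k, [/\ P k, `|Y k a - y a| <= e, `|Y k b - y b| <= e
                & `|Y k c - y c| <= e].
Proof.
move=> Yrho; have [G [GU Goo]] := ultraFilterLemma eventually_filter.
have lim_ex t : exists l : 'rV[R]_n, D t -> Y k t @[k --> G] --> l.
  have [Dt|nDt] := pselect (D t); last by exists 0.
  have [|l [_ lcl]] := @compact_normr_le rho (Y k t @[k --> G]) _.
    by apply: (@filterE _ G) => k; exact: Yrho.
  (* If the ultrafilter missed the preimage of a neighbourhood of [l], it would contain the
     complement, which contradicts that [l] is a cluster point. *)
  exists l => _ A lA; have [//|GnA] := in_ultra_setVsetC (Y ^~ t @^-1` A) GU.
  have : (Y k t @[k --> G]) (~` A) by [].
  by move=> /lcl/(_ lA)[x []].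
have [y yP] := choice lim_ex; exists y => a b c e P Da Db Dc e0 Poo.
have near_y t : D t -> \forall k \near G, `|Y k t - y t| <= e.
  move=> /yP/cvgr_distC_le; exact.
have : \forall k \near G, [/\ P k, `|Y k a - y a| <= e, `|Y k b - y b| <= e
                & `|Y k c - y c| <= e].
  near=> k; split; near: k;
    [exact: Goo|exact: near_y|exact: near_y|exact: near_y].
exact: filter_ex.
Unshelve. all: by end_near. Qed.

End UltrafilterLimit.

(** * Polygons driven by frozen primitives *)

Section EulerLimit.
Context {R : realType} {n : nat}.
(** [G v] plays the role of the time primitive of the field frozen at [v]; [X k] lists the nodes of
    the [k]-th polygon and [Z k] the points where the field is frozen on each step. *)
Variables (G : 'rV[R]_n -> R -> 'rV[R]_n) (T L rho : R).
Hypotheses (T_gt0 : 0 < T) (L_ge0 : 0 <= L).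
Hypothesis G_lip : forall v (a b : R),
  `|v| <= rho -> 0 <= a -> a <= b -> b <= T ->
  `|G v b - G v a| <= L * (b - a).
Hypothesis G_equi : forall e : R, 0 < e -> exists2 d : R, 0 < d &
  forall v w (a b : R), `|v| <= rho -> `|w| <= rho -> `|v - w| <= d ->
  0 <= a -> a <= b -> b <= T ->
  `|(G v b - G v a) - (G w b - G w a)| <= e * (b - a).
Variables (N : nat -> nat) (X Z : nat -> nat -> 'rV[R]_n).
Hypothesis N_ge : forall k, (k < N k)%N.

Let h k : R := T / (N k)%:R.

Hypothesis X_step : forall k i, (i < N k)%N ->
  X k i.+1 = X k i + (G (Z k i) (i.+1%:R * h k) - G (Z k i) (i%:R * h k)).
Hypothesis X_bound : forall k i, (i <= N k)%N -> `|X k i| <= rho.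
Hypothesis Z_bound : forall k i, (i <= N k)%N -> `|Z k i| <= rho.
Hypothesis Z_near : forall e : R, 0 < e ->
  \forall k \near \oo, forall i, (i <= N k)%N -> `|Z k i - X k i| <= e.

Lemma steps_gt0 k : 0 < (N k)%:R :> R.
Proof. by rewrite ltr0n (leq_ltn_trans _ (N_ge k)). Qed.

Lemma mesh_gt0 k : 0 < h k.
Proof. by rewrite divr_gt0// steps_gt0. Qed.

Lemma steps_mesh k : (N k)%:R * h k = T.
Proof. by rewrite mulrC divfK// gt_eqF// steps_gt0. Qed.

Lemma grid_le k i j : (i <= j)%N -> i%:R * h k <= j%:R * h k.
Proof. by move=> ij; rewrite ler_wpM2r ?ler_nat// ltW// mesh_gt0. Qed.

Lemma grid_leT k i : (i <= N k)%N -> i%:R * h k <= T.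
Proof. by move=> iN; rewrite -[leRHS](steps_mesh k) grid_le. Qed.

Lemma grid_ge0 k i : 0 <= i%:R * h k.
Proof. by rewrite mulr_ge0// ltW// mesh_gt0. Qed.

Lemma mesh_small e : 0 < e -> \forall k \near \oo, h k <= e.
Proof.
move=> e0; have Te : 0 < e / T by rewrite divr_gt0.
near=> k; rewrite /h ler_pdivrMr ?steps_gt0//.
have : k.+1%:R^-1 < e / T.
  by near: k; exact: (near_infty_natSinv_lt (PosNum Te)).
rewrite ltr_pdivlMr// mulrC ltr_pdivrMr// => /ltW/le_trans; apply.
by rewrite ler_pM2l// ler_nat.
Unshelve. all: by end_near. Qed.

Lemma polygon_lip k i j : (i <= j)%N -> (j <= N k)%N ->
  `|X k j - X k i| <= L * (j%:R * h k - i%:R * h k).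
Proof.
move=> ij; rewrite -(subnK ij); elim: (j - i)%N => [|m ih] mN.
  by rewrite !subrr normr0 mulr0.
rewrite addSn X_step// addrAC.
apply: (le_trans (ler_normD _ _)); apply: (le_trans (lerD (ih (ltnW mN)) _)).
  apply: G_lip;
    [exact/Z_bound/ltnW|exact: grid_ge0|exact: grid_le|exact: grid_leT].
by rewrite -mulrDr addrC addrA subrK.
Qed.

(** On each step the increment of [G (Z k l)] is replaced by that of [G v] at a cost of [e] times
    the step length; the costs and the increments of [G v] telescope. *)
Lemma polygon_increment k i j v e d : (i <= j)%N -> (j <= N k)%N ->
  `|v| <= rho ->
  (forall w a b, `|w| <= rho -> `|w - v| <= d -> 0 <= a -> a <= b -> b <= T ->
    `|(G w b - G w a) - (G v b - G v a)| <= e * (b - a)) ->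
  (forall l, (i <= l)%N -> (l <= j)%N -> `|Z k l - v| <= d) ->
  `|X k j - X k i - (G v (j%:R * h k) - G v (i%:R * h k))| <=
  e * (j%:R * h k - i%:R * h k).
Proof.
move=> ij + vrho Gv; rewrite -(subnK ij); elim: (j - i)%N => [|m ih] mN Zv.
  by rewrite !subrr normr0 mulr0.
rewrite addSn X_step//.
set g1 := G _ _; set g2 := G _ _; set g3 := G v _; set g4 := G v _.
set g5 := G v ((m + i)%:R * h k).
have -> : X k (m + i)%N + (g1 - g2) - X k i - (g3 - g4) =
  (X k (m + i)%N - X k i - (g5 - g4)) + ((g1 - g2) - (g3 - g5)).
  by apply/rowP => u; rewrite !mxE; ring.
apply: (le_trans (ler_normD _ _)).
have H1 := ih (ltnW mN) (fun l il lm => Zv l il (leqW lm)).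
have H2 : `|g1 - g2 - (g3 - g5)| <=
    e * ((m + i).+1%:R * h k - (m + i)%:R * h k).
  apply: Gv; [exact/Z_bound/ltnW|apply: Zv; [exact: leq_addl|exact: leqnSn]|
    exact: grid_ge0|exact: grid_le|exact: grid_leT].
apply: (le_trans (lerD H1 H2)).
by rewrite -mulrDr addrC addrA subrK.
Qed.

(** Polygons are sampled at the last node not after [t], so that no interpolation between nodes is
    needed. *)
Definition grid_index k t : nat := Num.truncn (t / h k).

Lemma grid_index_le k t : 0 <= t -> (grid_index k t)%:R * h k <= t.
Proof.
move=> t0; have th : 0 <= t / h k by rewrite divr_ge0// ltW// mesh_gt0.
by have /andP[+ _] := truncn_itv th; rewrite ler_pdivlMr// mesh_gt0.
Qed.

Lemma grid_index_gt k t : 0 <= t -> t - h k <= (grid_index k t)%:R * h k.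
Proof.
move=> t0; have th : 0 <= t / h k by rewrite divr_ge0// ltW// mesh_gt0.
have /andP[_] := truncn_itv th; rewrite ltr_pdivrMr ?mesh_gt0// => /ltW.
by rewrite lerBlDr -natr1 mulrDl mul1r.
Qed.

Lemma grid_index_leN k t : 0 <= t -> t <= T -> (grid_index k t <= N k)%N.
Proof.
move=> t0 tT; rewrite -(ler_nat R) -(ler_pM2r (mesh_gt0 k)) steps_mesh.
exact: le_trans (grid_index_le k t0) tT.
Qed.

Lemma grid_index_mono k a b : a <= b -> (grid_index k a <= grid_index k b)%N.
Proof.
by move=> ab; apply: le_truncn; rewrite ler_wpM2r// invr_ge0 ltW// mesh_gt0.
Qed.

(** The third clause is an integral-free form of the equation: over a short interval [y] moves like
    the primitive frozen at any [y c] of that interval. The last clause transfers eventual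
    properties of the polygons to the limit. *)
Lemma euler_limit : exists y : R -> 'rV[R]_n,
  [/\ forall t, 0 <= t <= T -> `|y t| <= rho,
      forall a b : R, 0 <= a -> a <= b -> b <= T -> `|y b - y a| <= L * (b - a),
      forall e : R, 0 < e -> exists2 d : R, 0 < d & forall a c b : R,
        0 <= a -> a <= c -> c <= b -> b <= T -> b - a <= d ->
        `|y b - y a - (G (y c) b - G (y c) a)| <= e * (b - a)
    & forall (t e : R) (P : set nat), 0 <= t <= T -> 0 < e ->
        (\forall k \near \oo, P k) ->
        exists2 k, P k & `|X k (grid_index k t) - y t| <= e].
Proof.
have L0 := L_ge0; have T0 := T_gt0.
have [|y yP] := @ultrafilter_limit R n (fun k t => X k (grid_index k t))
    [set t | 0 <= t <= T] rho.
  by move=> k t /andP[t0 tT]; exact/X_bound/grid_index_leN.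
have yrho t : 0 <= t <= T -> `|y t| <= rho.
  move=> t0T; apply/ler_addgt0Pr => e e0.
  have [k [_ H _ _]] := yP t t t e setT t0T t0T t0T e0 filterT.
  have /andP[t0 tT] := t0T.
  rewrite -(subrK (X k (grid_index k t)) (y t)) addrC.
  rewrite (le_trans (ler_normD _ _))// lerD//; last by rewrite distrC.
  exact/X_bound/grid_index_leN.
exists y; split => //; last first.
- move=> t e P t0T e0 Poo.
  by have [k [Pk H _ _]] := yP t t t e P t0T t0T t0T e0 Poo; exists k.
- move=> e e0; have [d d0 Gd] := G_equi e0.
  (* With [b - a] and the mesh both at most this, [L * (b - a + h k)] is at most [d / 2]. The two
     errors [d / 4], of [Z] against [X] and of [X] against [y c], then keep [Z k l] within [d] of
     [y c]. *)
  have dL : 0 < d / (4 * (L + 1)).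
    by rewrite divr_gt0// mulr_gt0// ltr_wpDl.
  exists (d / (4 * (L + 1))) => // a c b a0 ac cb bT bad.
  apply/ler_addgt0Pr => eta eta0.
  have a0T : 0 <= a <= T by apply/andP; split; lra.
  have b0T : 0 <= b <= T by apply/andP; split; lra.
  have c0T : 0 <= c <= T by apply/andP; split; lra.
  (* The slack [eta] is shared: [eta / 4] for each of the two endpoint limits, and
     [(e + 2 * L) * h k <= eta / 2] for moving the ends of the interval to nodes. *)
  have K0 : 0 < Num.min (eta / (2 * (e + 2 * L + 1))) (d / (4 * (L + 1))).
    rewrite lt_min dL andbT divr_gt0// mulr_gt0//; lra.
  have d40 : 0 < d / 4 by lra.
  have e'0 : 0 < Num.min (d / 4) (eta / 4) by rewrite lt_min d40; lra.
  have [k [[hk Zk] Ya Yb Yc]] := yP a b c _ _ a0T b0T c0T e'0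
    (filterI (mesh_small K0) (Z_near d40)).
  move: hk; rewrite le_min => /andP[hk1 hk2].
  move: Ya Yb Yc; rewrite !le_min => /andP[_ Ya] /andP[_ Yb] /andP[Yc _].
  have h0 := mesh_gt0 k.
  have {}hk1 : (e + 2 * L + 1) * h k <= eta / 2.
    move: hk1; rewrite ler_pdivlMr; [lra|rewrite mulr_gt0//; lra].
  have Ld : L * (d / (4 * (L + 1))) <= d / 4.
    rewrite mulrA ler_pdivrMr; [nra|rewrite mulr_gt0//; lra].
  have Lba : L * (b - a + h k) <= d / 2.
    have : L * (b - a) <= L * (d / (4 * (L + 1))) by rewrite ler_wpM2l.
    have : L * h k <= L * (d / (4 * (L + 1))) by rewrite ler_wpM2l.
    lra.
  set i := grid_index k a; set j := grid_index k b.
  have ij : (i <= j)%N by apply: grid_index_mono; lra.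
  have jN : (j <= N k)%N by apply: grid_index_leN; lra.
  have ia : i%:R * h k <= a by exact: grid_index_le.
  have ai : a - h k <= i%:R * h k by exact: grid_index_gt.
  have jb : j%:R * h k <= b by apply: grid_index_le; lra.
  have bj : b - h k <= j%:R * h k by apply: grid_index_gt; lra.
  have vrho : `|y c| <= rho by exact: yrho.
  have Zc l : (i <= l)%N -> (l <= j)%N -> `|Z k l - y c| <= d.
    move=> il lj.
    have lN := leq_trans lj jN.
    have ic : (i <= grid_index k c)%N by exact: grid_index_mono.
    have cj : (grid_index k c <= j)%N by exact: grid_index_mono.
    have Xlc : `|X k l - X k (grid_index k c)| <= L * (b - a + h k).
      have gl := grid_le k il; have gj := grid_le k lj.
      have gic := grid_le k ic; have gcj := grid_le k cj.
      have [lc|cl] := leqP l (grid_index k c).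
        rewrite distrC (le_trans (polygon_lip lc _))//.
          exact: leq_trans cj jN.
        by rewrite ler_wpM2l//; lra.
      rewrite (le_trans (polygon_lip (ltnW cl) lN))//.
      by rewrite ler_wpM2l//; lra.
    have -> : Z k l - y c = (Z k l - X k l) + (X k l - X k (grid_index k c)) +
       (X k (grid_index k c) - y c) by rewrite !addrA !subrK.
    rewrite (le_trans (ler_normD _ _))//.
    have := ler_normD (Z k l - X k l) (X k l - X k (grid_index k c)).
    have := Zk l lN; lra.
  have main : `|X k j - X k i - (G (y c) (j%:R * h k) - G (y c) (i%:R * h k))|
      <= e * (j%:R * h k - i%:R * h k).
    apply: (@polygon_increment _ _ _ _ _ d) => // w s t wrho wc s0 st tT.
    exact: Gd.
  have Gb : `|G (y c) b - G (y c) (j%:R * h k)| <= L * h k.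
    rewrite (le_trans (G_lip vrho (grid_ge0 k j) jb bT))// ler_wpM2l//; lra.
  have Ga : `|G (y c) a - G (y c) (i%:R * h k)| <= L * h k.
    have aT : a <= T by lra.
    rewrite (le_trans (G_lip vrho (grid_ge0 k i) ia aT))// ler_wpM2l//; lra.
  have eji : e * (j%:R * h k - i%:R * h k) <= e * (b - a + h k).
    by rewrite ler_wpM2l//; lra.
  set Gvj := G (y c) (j%:R * h k) in main Gb *.
  set Gvi := G (y c) (i%:R * h k) in main Ga *.
  have -> : y b - y a - (G (y c) b - G (y c) a) =
    (X k j - X k i - (Gvj - Gvi)) - (X k j - y b) + (X k i - y a)
    - (G (y c) b - Gvj) + (G (y c) a - Gvi).
    by apply/rowP => u; rewrite !mxE; ring.
  rewrite (le_trans (ler_normD _ _))//.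
  rewrite (le_trans (lerD (ler_normB _ _) (lexx _)))//.
  rewrite (le_trans (lerD (lerD (ler_normD _ _) (lexx _)) (lexx _)))//.
  rewrite (le_trans
    (lerD (lerD (lerD (ler_normB _ _) (lexx _)) (lexx _)) (lexx _)))//.
  lra.
- move=> a b a0 ab bT; apply/ler_addgt0Pr => eta eta0.
  have a0T : 0 <= a <= T by apply/andP; split; lra.
  have b0T : 0 <= b <= T by apply/andP; split; lra.
  have e0 : 0 < eta / 4 by lra.
  have K0 : 0 < eta / (2 * (L + 1)) by rewrite divr_gt0// mulr_gt0//; lra.
  have [k [hk Ya Yb _]] := yP a b b _ _ a0T b0T b0T e0 (mesh_small K0).
  set i := grid_index k a; set j := grid_index k b.
  have {}hk : L * h k <= eta / 2.
    have h0 := mesh_gt0 k.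
    move: hk; rewrite ler_pdivlMr; [nra|rewrite mulr_gt0//; lra].
  have ij : (i <= j)%N by apply: grid_index_mono; lra.
  have jN : (j <= N k)%N by apply: grid_index_leN; lra.
  have ai : a - h k <= i%:R * h k by exact: grid_index_gt.
  have jb : j%:R * h k <= b by apply: grid_index_le; lra.
  have : L * (j%:R * h k - i%:R * h k) <= L * (b - a + h k).
    by rewrite ler_wpM2l//; lra.
  have := polygon_lip ij jN.
  have -> : y b - y a = (X k j - X k i) - (X k j - y b) + (X k i - y a).
    by apply/rowP => u; rewrite !mxE; ring.
  have := ler_normD (X k j - X k i - (X k j - y b)) (X k i - y a).
  have := ler_normB (X k j - X k i) (X k j - y b).
  lra.
Qed.

End EulerLimit.

(** * Proximal Euler polygons *)

(** Each step multiplies the bound by [1 + K * h], which is at most [expR (K * h)]. *)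
Lemma discrete_gronwall (R : realType) (x : nat -> R) (K h : R) (i : nat) :
  0 <= K -> 0 <= h ->
  0 <= x 0%N ->
  (forall j, (j < i)%N -> x j.+1 <= x j + K * x j * h) ->
  x i <= x 0%N * expR (K * (i%:R * h)).
Proof.
move=> K0 h0 x0; elim: i => [_|i ih xS].
  by rewrite mul0r mulr0 expR0 mulr1.
apply: (le_trans (xS i (ltnSn i))).
have -> : x i + K * x i * h = x i * (1 + K * h) by ring.
have Kh : 0 <= K * h by rewrite mulr_ge0.
apply: (@le_trans _ _ (x 0%N * expR (K * (i%:R * h)) * (1 + K * h))).
  by rewrite ler_wpM2r ?addr_ge0// ih// => j ji; exact/xS/ltnW.
rewrite -natr1 mulrDl mul1r mulrDr expRD -mulrA ler_wpM2l//.
by rewrite ler_wpM2l ?expR_ge0// expR_ge1Dx.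
Qed.

Section ProximalEuler.
Context {R : realType} {n : nat}.
Variables (Psi : 'rV[R]_n -> R) (xbar : 'rV[R]_n) (r : R).
Hypothesis Psi_lsc : lower_semicontinuous (fun x => (Psi x)%:E).
Hypothesis r_gt0 : 0 < r.
Variables (G : 'rV[R]_n -> R -> 'rV[R]_n) (T c1 c2 : R).
Hypotheses (T_gt0 : 0 < T) (c1_ge0 : 0 <= c1) (c2_ge0 : 0 <= c2).
Hypothesis G_growth : forall v (a b : R), 0 <= a -> a <= b -> b <= T ->
  `|G v b - G v a| <= (c1 + c2 * `|v|) * (b - a).
Hypothesis G_equi : forall rho e : R, 0 < e -> exists2 d : R, 0 < d &
  forall v w (a b : R), `|v| <= rho -> `|w| <= rho -> `|v - w| <= d ->
  0 <= a -> a <= b -> b <= T ->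
  `|(G v b - G v a) - (G w b - G w a)| <= e * (b - a).
Hypothesis G_decr : forall y zeta (a b : R), eball xbar r y ->
  prox_subdiff Psi y zeta -> 0 <= a -> a <= b -> b <= T ->
  dot zeta (G y b - G y a) <= 0.

(** Before time [delta] the nodes are so close to [xbar] that the proximal points stay in the half
    ball, where [G_decr] controls the Moreau envelope; the polygons continue up to [T] to give a
    curve on the whole interval. *)
Lemma prox_euler_limit : exists delta rho' L' : R, exists y : R -> 'rV[R]_n,
  [/\ [/\ 0 < delta, 0 <= rho' & 0 <= L'],
      y 0 = xbar,
      forall t : R, 0 <= t <= T ->
        `|y t| <= rho' /\ (t < delta -> Psi (y t) <= Psi xbar),
      forall a b : R, 0 <= a -> a <= b -> b <= T -> `|y b - y a| <= L' * (b - a)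
    & forall e : R, 0 < e -> exists2 d : R, 0 < d & forall a c b : R,
        0 <= a -> a <= c -> c <= b -> b <= T -> b - a <= d ->
        `|y b - y a - (G (y c) b - G (y c) a)| <= e * (b - a)].
Proof.
(* [s] bounds the ball around [xbar], [K] is the Gronwall rate of [1 + |X|], [rho] bounds nodes and
   frozen points, and [L] bounds the speed. [delta] makes [n.+1 * L * delta] at most [r / 8], the
   factor [n.+1] passing from the sup norm to the Euclidean one. *)
pose s := `|xbar| + r.
pose K := c1 + c2 * (s + 1).
pose rho := (1 + `|xbar|) * expR (K * T) + s.
pose L := c1 + c2 * rho.
pose delta := r / (8 * n.+1%:R * (L + 1)).
(* With [lam k = k + 1], the total increase of the Moreau envelope is of order
   [lam k * h k]. *)
pose N k := (k.+1 ^ 2)%N.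
pose h k : R := T / (N k)%:R.
have [[[r0 T0] c10] c20] := (r_gt0, T_gt0, c1_ge0, c2_ge0).
have /choice[P PP] (lx : R * 'rV[R]_n) :
    exists y, is_prox Psi xbar r lx.1 lx.2 y.
  exact: is_prox_ex.
have [ym _ ymP] : exists2 x, eball xbar r x &
    forall y, eball xbar r y -> Psi x <= Psi y.
  apply: lsc_min_compact => //; first exact: compact_eball (ltW r0).
  by exists xbar; exact: eball_center (ltW r0).
have Ps lx : `|P lx| <= s.
  have [+ _] := PP lx; rewrite /eball /= => /(le_trans (normr_le_enorm _)) h1.
  rewrite -(subrK xbar (P lx)) addrC (le_trans (ler_normD _ _))// lerD2l//.
have s0 : 0 <= s by rewrite addr_ge0// ltW.
have K0 : 0 <= K by rewrite addr_ge0// mulr_ge0//; lra.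
have rho0 : 0 <= rho by rewrite addr_ge0// mulr_ge0 ?expR_ge0// addr_ge0.
have L0 : 0 <= L by rewrite addr_ge0// mulr_ge0.
have delta0 : 0 < delta by rewrite divr_gt0// mulr_gt0//; lra.
have N0 k : 0 < (N k)%:R :> R by rewrite ltr0n expn_gt0.
have h0 k : 0 < h k by rewrite divr_gt0.
have Nh k : (N k)%:R * h k = T by rewrite mulrC divfK// gt_eqF.
pose lam k : R := k.+1%:R.
have lam0 k : 0 < lam k by rewrite ltr0n.
(* The evaluation point is the proximal point of the node as long as the
   polygon is near [xbar], and the node itself afterwards. *)
pose Zs k (i : nat) x := if i%:R * h k < delta then P (lam k, x) else x.
pose X k := fix X i := if i is j.+1 then
    X j + (G (Zs k j (X j)) (j.+1%:R * h k) - G (Zs k j (X j)) (j%:R * h k))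
  else xbar.
pose Z k i := Zs k i (X k i).
have XS k i : X k i.+1 =
  X k i + (G (Z k i) (i.+1%:R * h k) - G (Z k i) (i%:R * h k)) by [].
have grid k i : (i < N k)%N -> [/\ 0 <= i%:R * h k, i%:R * h k <= i.+1%:R * h k,
    i.+1%:R * h k <= T & i.+1%:R * h k - i%:R * h k = h k].
  move=> iN; split.
  - by rewrite mulr_ge0// ltW.
  - by rewrite ler_wpM2r ?ler_nat// ltW.
  - by rewrite -[leRHS](Nh k) ler_wpM2r ?ler_nat// ltW.
  - by rewrite -natr1 mulrDl mul1r addrAC subrr add0r.
have ZX k i : `|Z k i| <= `|X k i| + s.
  rewrite /Z /Zs; case: ifP => _; last by rewrite lerDl.
  by rewrite (le_trans (Ps _))// lerDr.
have Xs k i : (i <= N k)%N -> `|X k i| + s <= rho.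
  move=> iN; rewrite lerD2r.
  have gw : 1 + `|X k i| <= (1 + `|xbar|) * expR (K * (i%:R * h k)).
    apply: (@discrete_gronwall _ (fun j => 1 + `|X k j|)) => //.
      exact: ltW.
    move=> j ji; rewrite XS -addrA lerD2l (le_trans (ler_normD _ _))// lerD2l.
    have [g0 g1 g2 g3] := grid k j (leq_trans ji iN).
    rewrite (le_trans (G_growth _ g0 g1 g2))// g3 ler_wpM2r ?(ltW (h0 k))//.
    have := ler_wpM2l c20 (ZX k j); rewrite /K; have := normr_ge0 (X k j).
    have : 0 <= c1 * `|X k j| by rewrite mulr_ge0.
    have : 0 <= c2 * s * `|X k j| by rewrite !mulr_ge0.
    lra.
  apply: (@le_trans _ _ (1 + `|X k i|)); first by rewrite lerDr.
  apply: (le_trans gw); rewrite ler_wpM2l ?addr_ge0// ler_expR ler_wpM2l//.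
  by rewrite -[leRHS](Nh k) ler_wpM2r ?ler_nat// ltW.
have Xrho k i : (i <= N k)%N -> `|X k i| <= rho.
  by move=> /(Xs k); apply: le_trans; rewrite lerDl.
have Zrho k i : (i <= N k)%N -> `|Z k i| <= rho.
  by move=> /(Xs k); apply: le_trans.
have Glip v (a b : R) : `|v| <= rho -> 0 <= a -> a <= b -> b <= T ->
    `|G v b - G v a| <= L * (b - a).
  move=> vrho a0 ab bT; rewrite (le_trans (G_growth _ a0 ab bT))//.
  by rewrite ler_wpM2r ?subr_ge0// lerD2l ler_wpM2l.
have Xlip k i : (i <= N k)%N -> `|X k i - xbar| <= L * (i%:R * h k).
  elim: i => [_|i ih iN]; first by rewrite subrr normr0 mul0r mulr0.
  have [g0 g1 g2 g3] := grid k i iN.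
  rewrite XS addrAC (le_trans (ler_normD _ _))//.
  have := Glip _ _ _ (Zrho k i (ltnW iN)) g0 g1 g2.
  by have := ih (ltnW iN); nra.
(* [M] bounds the decrease of [Psi] from [xbar] within the ball. [C / k.+1] is the sum over all
   [N k] steps of the envelope gain [lam k * n * (L * h k)^2]. *)
pose M := Psi xbar - Psi ym.
have M0 : 0 <= M by rewrite subr_ge0 ymP//; exact: eball_center (ltW r0).
pose C := T ^+ 2 * n%:R * L ^+ 2.
have C0 : 0 <= C by rewrite mulr_ge0 ?sqr_ge0// mulr_ge0 ?sqr_ge0.
have small (e A : R) : 0 < e -> \forall k \near \oo, A / k.+1%:R <= e.
  move=> e0; have eA : 0 < e / (`|A| + 1).
    by rewrite divr_gt0// ltr_wpDl.
  near=> k; apply: (@le_trans _ _ ((`|A| + 1) / k.+1%:R)).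
    by rewrite ler_wpM2r ?invr_ge0// (le_trans (ler_norm A))// lerDl.
  have : k.+1%:R^-1 < e / (`|A| + 1).
    by near: k; exact: (near_infty_natSinv_lt (PosNum eA)).
  by rewrite ltr_pdivlMr ?ltr_wpDl// mulrC => /ltW.
have descent k i : M / k.+1%:R <= (r / 8) ^+ 2 -> (i <= N k)%N ->
    i%:R * h k < delta ->
    Psi (Z k i) + lam k * dot (Z k i - X k i) (Z k i - X k i) <=
    Psi xbar + i%:R * (lam k * (n%:R * (L * h k) ^+ 2)).
  move=> Mr; elim: i => [_ i0|i ih iN iS].
    (* The polygon starts at [xbar], and with [xbar] itself as competitor the envelope there is at
       most [Psi xbar]. *)
    rewrite mul0r addr0 /Z /Zs i0; have [_ /(_ xbar)] := PP (lam k, X k 0%N).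
    rewrite /= subrr dot00 mulr0 addr0; apply.
    exact: eball_center (ltW r0).
  have [g0 g1 g2 g3] := grid k i iN.
  have id : i%:R * h k < delta by exact: le_lt_trans iS.
  apply: (@le_trans _ _ (Psi (Z k i) +
    lam k * dot (Z k i - X k i) (Z k i - X k i) +
    lam k * (n%:R * (L * h k) ^+ 2))); last first.
    rewrite [i.+1%:R * _](_ : _ = i%:R * (lam k * (n%:R * (L * h k) ^+ 2)) +
      lam k * (n%:R * (L * h k) ^+ 2)); last by rewrite -natr1 mulrDl mul1r.
    by rewrite addrA lerD2r ih// ltnW.
  have ZP : Z k i = P (lam k, X k i) by rewrite /Z /Zs id.
  have prZ : is_prox Psi xbar r (lam k) (X k i) (Z k i).
    by rewrite ZP; exact: PP.
  have prZS : is_prox Psi xbar r (lam k) (X k i.+1) (Z k i.+1).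
    by rewrite /Z /Zs iS; exact: PP.
  have dX : dot (X k i - xbar) (X k i - xbar) <= (r / 8) ^+ 2.
    apply: (le_trans (dot_le_normr _)).
    apply: (@le_trans _ _ (n.+1%:R ^+ 2 * (L * delta) ^+ 2)).
      apply: ler_pM => //.
        rewrite -natrX ler_nat (leq_trans (leqnSn n))//.
        by rewrite expnS expn1 leq_pmulr.
      have Ld : `|X k i - xbar| <= L * delta.
        by rewrite (le_trans (Xlip k i (ltnW iN)))// ler_wpM2l// ltW.
      have Ld0 : 0 <= L * delta by rewrite mulr_ge0// ltW.
      by rewrite lerXn2r// nnegrE.
    have nLd0 : 0 <= n.+1%:R * (L * delta) by rewrite mulr_ge0// mulr_ge0// ltW.
    have nLd : n.+1%:R * (L * delta) <= r / 8.
      rewrite /delta !mulrA ler_pdivrMr; last by rewrite !mulr_gt0//; lra.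
      have : 0 <= r * n.+1%:R by rewrite mulr_ge0// ltW.
      lra.
    have r80 : 0 <= r / 8 by lra.
    by rewrite -exprMn lerXn2r// nnegrE.
  have dXN : dot (xbar - X k i) (xbar - X k i) <= (r / 8) ^+ 2.
    by rewrite -opprB dotNl dotNr opprK.
  have [BZ _] := prZ.
  have dZX := dot_is_prox_le r0 (lam0 k) prZ (ymP _ BZ).
  (* The squared distance from [Z] to [X] is at most [2 (r/8)^2], and that from [X] to [xbar] at
     most [(r/8)^2]; doubling and adding gives [6 r^2 / 64], below [(r/2)^2]. *)
  have dZ : dot (Z k i - xbar) (Z k i - xbar) <= (r / 2) ^+ 2.
    have -> : Z k i - xbar = (Z k i - X k i) + (X k i - xbar).
      by rewrite addrA subrK.
    apply: (le_trans (dotDD_le _ _)).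
    move: Mr dZX dX dXN; rewrite -/M -/(lam k) !expr_div_n.
    have := sqr_ge0 r; set rr := r ^+ 2.
    set m := M / lam k; set p := dot (Z k i - X k i) _.
    by set q1 := dot (xbar - _) _; set q2 := dot _ _; lra.
  have sub := is_prox_subgrad r0 (lam0 k) prZ dZ.
  (* The subgradient is [2 * lam k] times [X - Z], so its sign against the increment is precisely
     what the envelope descent requires. *)
  have := G_decr BZ sub g0 g1 g2.
  rewrite dotZl pmulr_rle0; last by rewrite mulr_gt0.
  move=> decr; move: prZS; rewrite XS => prZS.
  apply: (le_trans (is_prox_descent (ltW (lam0 k)) prZ prZS decr)).
  rewrite lerD2l ler_wpM2l ?(ltW (lam0 k))// (le_trans (dot_le_normr _))//.
  have Lh0 : 0 <= L * h k by rewrite mulr_ge0// ltW.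
  have := Glip _ _ _ (Zrho k i (ltnW iN)) g0 g1 g2; rewrite g3 => GLh.
  by rewrite ler_wpM2l// lerXn2r// nnegrE.
have descent' k i : M / k.+1%:R <= (r / 8) ^+ 2 -> (i <= N k)%N ->
    i%:R * h k < delta ->
    Psi (Z k i) + lam k * dot (Z k i - X k i) (Z k i - X k i) <=
    Psi xbar + C / k.+1%:R.
  move=> Mr iN id; apply: (le_trans (descent k i Mr iN id)); rewrite lerD2l.
  have -> : C / k.+1%:R = (N k)%:R * (lam k * (n%:R * (L * h k) ^+ 2)).
    rewrite /C /lam /h /N natrX; have : k.+1%:R != 0 :> R by [].
    by move: (k.+1%:R) => u u0; field.
  rewrite ler_wpM2r ?ler_nat// mulr_ge0 ?(ltW (lam0 k))//.
  by rewrite mulr_ge0// sqr_ge0.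
have rr : 0 < (r / 8) ^+ 2 by rewrite exprn_gt0// divr_gt0.
(* Since [Psi (Z k i) >= Psi ym], the envelope bound leaves [lam k * |Z - X|^2 <= M + C], uniformly
   in [i]; from [delta] on, [Z] equals [X]. *)
have Znear (e : R) : 0 < e ->
    \forall k \near \oo, forall i, (i <= N k)%N -> `|Z k i - X k i| <= e.
  move=> e0; have e20 : 0 < e ^+ 2 by rewrite exprn_gt0.
  near=> k => i iN; have [id|] := ltP (i%:R * h k) delta; last first.
    by move=> id; rewrite /Z /Zs ltNge id subrr normr0 ltW.
  have Mr : M / k.+1%:R <= (r / 8) ^+ 2 by near: k; exact: small.
  have Ce : (M + C) / k.+1%:R <= e ^+ 2 by near: k; exact: small.
  apply: (le_trans (normr_le_enorm _)).
  rewrite -(@ler_pXn2r _ 2) ?nnegrE ?enorm_ge0 ?(ltW e0)// sqr_enorm.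
  apply: le_trans Ce; rewrite ler_pdivlMr// mulrC.
  have BZ : eball xbar r (Z k i).
    by rewrite /Z /Zs id; case: (PP (lam k, X k i)).
  have := descent' k i Mr iN id; have := ymP _ BZ.
  have : C / k.+1%:R <= C.
    by rewrite ler_pdivrMr// ler_peMr// ler1n.
  by rewrite -/(lam k) /M; set c := C / _; set p := lam k * _; lra.
have Nk k : (k < N k)%N by rewrite /N expnS expn1 leq_pmulr.
have [y [yrho ylip yG yX]] := euler_limit T0 L0 Glip
  (fun e e0 => G_equi rho e0) Nk
  (fun k i _ => XS k i)  Xrho Zrho Znear.
exists delta, rho, L, y; split => //.
  apply/eqP; rewrite -subr_eq0 -normr_le0; apply/ler_addgt0Pr => e e0.
  have T00 : (0 : R) <= 0 <= T by apply/andP; split; lra.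
  have [k _] := yX 0 e setT T00 e0 filterT.
  by rewrite /grid_index mul0r truncn0 add0r distrC.
move=> t t0T; split; first exact: yrho.
move=> td; rewrite leNgt; apply/negP => Psi_gt.
(* By lower semicontinuity [Psi] exceeds the midpoint [a] near [y t], hence at a frozen point
   [Z k i] close to it, while the envelope bound gives [Psi (Z k i) <= Psi xbar + C / k.+1 <= a]. *)
pose a := (Psi (y t) + Psi xbar) / 2.
have : nbhs (y t) [set x | a < Psi x].
  by apply: open_nbhs_nbhs; split; [exact: lsc_open_gt|rewrite /= /a; lra].
move=> /nbhs_normP[e /= e0 eP].
have e20 : 0 < e / 4 by lra.
have Ca : 0 < a - Psi xbar by rewrite /a; lra.
have [k [[[Mr Ck] Zk] Xk]] := yX t (e / 4) _ t0T e20
  (filterI (filterI (small _ M rr) (small _ C Ca)) (Znear _ e20)).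
have /andP[t0 tT] := t0T.
set i := grid_index T N k t in Xk.
have iN : (i <= N k)%N by exact: grid_index_leN.
have id : i%:R * h k < delta by apply: le_lt_trans td; exact: grid_index_le.
have : a < Psi (Z k i).
  apply: eP; rewrite /ball_ /= distrC.
  have -> : Z k i - y t = (Z k i - X k i) + (X k i - y t).
    by rewrite addrA subrK.
  rewrite (le_lt_trans (ler_normD _ _))//.
  by have := Zk i iN; lra.
apply/negP; rewrite -leNgt.
have := descent' k i Mr iN id.
have : 0 <= lam k * dot (Z k i - X k i) (Z k i - X k i).
  by rewrite mulr_ge0 ?dot_ge0// ltW.
set c := C / _ in Ck *; set p := lam k * _; lra.
Unshelve. all: by end_near. Qed.

End ProximalEuler.

(** * Primitives of Caratheodory fields *)

Section BorelRepresentative.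
Context {R : realType}.
Local Notation mu := (@lebesgue_measure R).

Lemma ae_forall_countable (I : countType) (P : I -> R -> Prop) :
  (forall i, {ae mu, forall x, P i x}) -> {ae mu, forall x, forall i, P i x}.
Proof.
move=> aeP; pose Q (k : nat) (x : R) :=
  if unpickle k is Some i then P i x else True.
have : \forall x \ae mu, forall k, Q k x.
  apply: ae_foralln => k; rewrite /Q.
  by case: (unpickle k) => [i|]; [exact: aeP|exact: aeW].
apply: filterS; first exact: (ae_filter_ringOfSetsType mu).
move=> x Qx i; have := Qx (pickle i).
by rewrite /Q pickleK.
Qed.

(* Bridges the gap between the Lebesgue measurability required by [classC] and
   the Borel sigma-algebra underlying [lebesgue_measure] and its integral. *)
Lemma borel_representative (D : set R) (f : R -> R) (C : R) :
  measurable D -> (forall t, D t -> `|f t| <= C) ->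
  (forall q : rat, (completed_algebra_gen mu).-sigma.-measurable
    (D `&` [set t | f t < ratr q])) ->
  exists g : R -> R, [/\ measurable_fun setT g, forall t, `|g t| <= `|C|
    & {ae mu, forall t, D t -> g t = f t}].
Proof.
rewrite g_sigma_completed_algebra_genE => mD fC mf.
have [B [N [mB nN BNE]]] : exists (B N : rat -> set R),
    [/\ forall q, measurable (B q : set (measurableTypeR R)),
        forall q, mu.-negligible (N q)
      & forall q, B q `|` N q = D `&` [set t | f t < ratr q]].
  have /choice[BN BNP] (q : rat) : exists BN : set R * set R,
      [/\ measurable (BN.1 : set (measurableTypeR R)), mu.-negligible BN.2
        & BN.1 `|` BN.2 = D `&` [set t | f t < ratr q]].
    by have [B mB [N nN BN]] := mf q; exists (B, N).
  by exists (fun q => (BN q).1), (fun q => (BN q).2); split => q; case: (BNP q).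
have [M [mM M0 NM]] : {ae mu, forall x, forall q, ~ N q x}.
  apply: ae_forall_countable => q; apply: (negligibleS _ (nN q)) => x /=.
  exact: contrapT.
have {}NM q x : N q x -> M x.
  by move=> Nx; apply: NM => /= /(_ q).
(* [M] is one Borel null set containing all the negligible parts [N q]. Off [M], the set where
   [f < x] is the union of the Borel parts [B q] over rationals [q <= x]; the default value 0
   contributes the rest of the line when [0 < x]. *)
pose g t : R := if t \in D `\` M then f t else 0.
have gE t : D t -> ~ M t -> g t = f t by move=> Dt Mt; rewrite /g mem_set.
exists g; split.
- apply: (measurability _ (RGenInftyO.measurableE R)) => //.
  move=> _ [_ [x ->] <-]; rewrite setTI.
  have -> : g @^-1` `]-oo, x[%classic =
      (\bigcup_(q : rat) (if ratr q <= x then B q `\` M else set0)) `|`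
      (if 0 < x then ~` (D `\` M) else set0).
    apply/seteqP; split => t /=; rewrite in_itv/=.
      rewrite /g; case: ifPn => [|nDM x0]; last first.
        by right; rewrite x0 /=; rewrite notin_setE in nDM.
      rewrite inE => -[Dt Mt] ftx; left.
      have [q] := rat_in_itvoo ftx; rewrite in_itv/= => /andP[fq qx].
      exists q => //; rewrite ltW//; split => //.
      have : (B q `|` N q) t by rewrite BNE.
      by case=> // /NM.
    case=> [[q _]|].
      case: ifPn => // qx [Bt Mt].
      have : (B q `|` N q) t by left.
      rewrite BNE => -[Dt /= ftq]; rewrite gE//.
      exact: lt_le_trans qx.
    case: ifPn => // x0 nDM; rewrite /g; case: ifPn => //.
    by rewrite inE.
  apply: measurableU.
    apply: bigcupT_measurable_rat => q; case: ifP => _; last exact: measurable0.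
    apply: measurableD; [exact: mB|exact: mM].
  case: ifP => _; last exact: measurable0.
  by apply/measurableC/measurableD => //; exact: mM.
- move=> t; rewrite /g; case: ifPn; last by rewrite normr0.
  by rewrite inE => -[Dt _]; rewrite (le_trans (fC t Dt))// ler_norm.
- exists M; split => // t /= nt; apply: contrapT => Mt; apply: nt => Dt.
  exact: gE.
Qed.

End BorelRepresentative.

(** * Integrals of bounded Borel functions *)

Section BoundedPrimitive.
Context {R : realType}.
Local Notation mu := (@lebesgue_measure R).
Implicit Types (g : R -> R) (A : set R).

Lemma bounded_integrable g (C : R) A : measurable A -> (mu A < +oo)%E ->
  measurable_fun setT g -> (forall t, `|g t| <= C) ->
  mu.-integrable A (EFin \o g).
Proof.
move=> mA Afin mg gC; apply: measurable_bounded_integrable => //.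
  exact: measurable_funS mg.
exists C; split; first exact: num_real.
by move=> M CM t _ /=; rewrite (le_trans (gC t))// ltW.
Qed.

Lemma lebesgue_measure_itv_lty (a b : R) (x y : bool) :
  (mu [set` Interval (BSide x a) (BSide y b)] < +oo)%E.
Proof.
by rewrite lebesgue_measure_itv/=; case: ifP => // _; rewrite -EFinB ltry.
Qed.

(** Truncating [g] at [c] leaves the integral unchanged and makes the almost everywhere bound hold
    everywhere. *)
Lemma Rintegral_le_ae g (C c : R) A : measurable A -> (mu A < +oo)%E ->
  measurable_fun setT g -> (forall t, `|g t| <= C) ->
  {ae mu, forall t, A t -> g t <= c} ->
  \int[mu]_(t in A) g t <= c * fine (mu A).
Proof.
move=> mA Afin mg gC gc; pose g' := fun t => Num.min (g t) c.
have mg' : measurable_fun setT g' by apply: measurable_minr.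
have g'C t : `|g' t| <= Num.max C `|c|.
  by rewrite /g' minEle le_max; case: ifP => _; rewrite ?gC ?lexx ?orbT.
have -> : \int[mu]_(t in A) g t = \int[mu]_(t in A) g' t.
  congr fine; apply: ae_eq_integral => //.
  - apply/measurable_EFinP; exact: measurable_funS mg.
  - apply/measurable_EFinP; exact: measurable_funS mg'.
  apply: filterS gc; first exact: (ae_filter_ringOfSetsType mu).
  by move=> t gt At; rewrite /g' min_l// gt.
rewrite -Rintegral_cst//; apply: le_Rintegral => //.
- exact: bounded_integrable g'C.
- by apply: (@bounded_integrable _ `|c|).
- by move=> t _; rewrite /g' ge_min lexx orbT.
Qed.

Lemma Rintegral_prim_sub g (C a b : R) :
  measurable_fun setT g -> (forall t, `|g t| <= C) -> 0 <= a -> a <= b ->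
  \int[mu]_(t in `[0, b]) g t - \int[mu]_(t in `[0, a]) g t =
  \int[mu]_(t in `]a, b]) g t.
Proof.
move=> mg gC a0 ab; apply: Rintegral_itvB; rewrite ?bnd_simp//.
by apply: bounded_integrable gC => //; exact: lebesgue_measure_itv_lty.
Qed.

Lemma Rintegral_prim_derive g (C : R) :
  measurable_fun setT g -> (forall t, `|g t| <= C) ->
  {ae mu, forall t : R, 0 < t ->
    is_derive t 1 (fun s => \int[mu]_(u in `[0, s]) g u : R) (g t)}.
Proof.
move=> mg gC; have intg y : mu.-integrable `[0, y] (EFin \o g).
  by apply: bounded_integrable gC => //; exact: lebesgue_measure_itv_lty.
have locg : locally_integrable [set: R] g.
  split => //; first exact: openT.
  move=> K _ cK; have mK := compact_measurable cK.
  by have /integrableP[] :=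
    bounded_integrable mK (compact_finite_measure cK) mg gC.
have := @FTC1 R g (BLeft 0) intg locg.
apply: filterS; first exact: (ae_filter_ringOfSetsType mu).
move=> t /= dt t0; have [|dg <-] := dt; first by rewrite lte_fin.
by rewrite derive1E; apply: derivableP.
Qed.

Lemma Rintegral_sum (I : finType) (g : I -> R -> R) (C : R) (al : I -> R) A :
  measurable A -> (mu A < +oo)%E ->
  (forall i, measurable_fun setT (g i)) -> (forall i t, `|g i t| <= C) ->
  \sum_i al i * \int[mu]_(t in A) g i t =
  \int[mu]_(t in A) (\sum_i al i * g i t).
Proof.
move=> mA Afin mg gC; elim: (index_enum I) => [|i s ih].
  rewrite big_nil; under eq_Rintegral do rewrite big_nil.
  by rewrite Rintegral_cst// mul0r.
rewrite big_cons ih -RintegralZl//; last first.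
  exact: (bounded_integrable mA Afin (mg i) (gC i)).
rewrite -RintegralD//; first by under [RHS]eq_Rintegral do rewrite big_cons.
- apply: (@bounded_integrable _ (`|al i| * C)) => //.
    exact: measurable_funM.
  by move=> t; rewrite normrM ler_wpM2l.
- apply: (@bounded_integrable _ (\sum_(j <- s) `|al j| * C)) => //.
    by apply: measurable_sum => j; exact: measurable_funM.
  move=> t; rewrite (le_trans (ler_norm_sum _ _ _))// ler_sum// => j _.
  by rewrite normrM ler_wpM2l.
Qed.

Lemma Rintegral_sum_le_ae (I : finType) (g : I -> R -> R) (C c : R)
    (al : I -> R) A :
  measurable A -> (mu A < +oo)%E ->
  (forall i, measurable_fun setT (g i)) -> (forall i t, `|g i t| <= C) ->
  {ae mu, forall t, A t -> \sum_i al i * g i t <= c} ->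
  \sum_i al i * \int[mu]_(t in A) g i t <= c * fine (mu A).
Proof.
move=> mA Afin mg gC gc; rewrite (Rintegral_sum _ mA Afin mg gC).
apply: (@Rintegral_le_ae _ (\sum_i `|al i| * C)) => //.
  by apply: measurable_sum => i; exact: measurable_funM.
move=> t; rewrite (le_trans (ler_norm_sum _ _ _))// ler_sum// => i _.
by rewrite normrM ler_wpM2l.
Qed.

End BoundedPrimitive.

(** * The primitive of a field frozen at a point *)

Section Primitive.
Context {R : realType} {n : nat}.
Local Notation mu := (@lebesgue_measure R).

Lemma lebesgue_measurable_coord (D : set R) (f : R -> 'rV[R]_n) (j : 'I_n)
    (q : R) :
  measurable D -> lebesgue_measurable_fun D f ->
  (completed_algebra_gen mu).-sigma.-measurable (D `&` [set t | f t 0 j < q]).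
Proof.
move=> mD mf; apply: (mf _ [set x | x 0 j < q]).
  by apply: sub_sigma_algebra; exists D => //; exists set0;
    [exact: negligible_set0|rewrite setU0].
apply: sub_sigma_algebra.
apply: (@open_comp _ _ (fun x : 'rV[R]_n => x 0 j) [set t | t < q]) => //.
by move=> x _; exact: coord_continuous.
Qed.

(* [G v] is the primitive of [f ^~ v].  Only its Lipschitz-type bounds and its
   derivative are kept: the rest of the proof is free of integrals. *)
Lemma classC_primitive (T : R) (f : R -> 'rV[R]_n -> 'rV[R]_n) : classC T f ->
  exists G : 'rV[R]_n -> R -> 'rV[R]_n,
    (forall v w zeta eta (c a b : R),
      {ae mu, forall t, 0 <= t <= T ->
        dot zeta (f t v) + dot eta (f t w) <= c} ->
      0 <= a -> a <= b -> b <= T ->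
      dot zeta (G v b - G v a) + dot eta (G w b - G w a) <= c * (b - a)) /\
    (forall v, {ae mu, forall t : R, 0 < t <= T ->
      forall j, is_derive t 1 (fun s => G v s 0 j) (f t v 0 j)}).
Proof.
case=> mf _ [c1 [c2 [c10 c20 fc]]].
have mI : measurable (`[0, T]%classic : set R) by [].
have fC v j t : `[0, T]%classic t -> `|f t v 0 j| <= c1 + c2 * enorm v.
  rewrite /= in_itv/= => tT; rewrite (le_trans (normr_coord_le _ _))//.
  exact: le_trans (normr_le_enorm _) (fc t v tT).
have /choice[g gP] (vj : 'rV[R]_n * 'I_n) : exists g : R -> R,
    [/\ measurable_fun setT g, forall t, `|g t| <= `|c1 + c2 * enorm vj.1|
    & {ae mu, forall t, `[0, T]%classic t -> g t = f t vj.1 0 vj.2}].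
  apply: borel_representative => // [t|q]; first exact: fC.
  exact: lebesgue_measurable_coord.
have mg vj : measurable_fun setT (g vj) by have [] := gP vj.
have gC vj t : `|g vj t| <= `|c1 + c2 * enorm vj.1| by have [_ + _] := gP vj.
have gf v : {ae mu, forall t, forall j,
    `[0, T]%classic t -> g (v, j) t = f t v 0 j}.
  by apply: ae_forall_countable => j; have [] := gP (v, j).
exists (fun v t => \row_j \int[mu]_(s in `[0, t]) g (v, j) s); split.
- move=> v w zeta eta c a b fle a0 ab bT.
  (* Indexing by a disjoint sum merges the coordinates at [v] and at [w], so that both inner
     products form one linear combination to integrate. *)
  pose gg (i : 'I_n + 'I_n) :=
    match i with inl j => g (v, j) | inr j => g (w, j) end.
  pose al (i : 'I_n + 'I_n) :=
    match i with inl j => zeta 0 j | inr j => eta 0 j end.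
  have := @Rintegral_sum_le_ae R ('I_n + 'I_n)%type gg
    (`|c1 + c2 * enorm v| + `|c1 + c2 * enorm w|) c al `]a, b]%classic.
  rewrite lebesgue_measure_itv/= lte_fin.
  have -> : (if a < b then (b%:E - a%:E)%E else 0%E) = (b - a)%:E.
    by case: ltP => // ba; rewrite (@le_anti _ _ a b) ?subrr// ab ba.
  rewrite /= ltry big_sumType/=.
  have dG u z : dot z (\row_j \int[mu]_(s in `[0, b]) g (u, j) s -
      \row_j \int[mu]_(s in `[0, a]) g (u, j) s) =
      \sum_j z 0 j * \int[mu]_(s in `]a, b]) g (u, j) s.
    apply: eq_bigr => j _; rewrite !mxE; congr (_ * _).
    exact: (Rintegral_prim_sub (mg _) (gC _)).
  rewrite !dG; apply => //.
  + by case => j; exact: mg.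
  + move=> [j|j] t; first by rewrite (le_trans (gC _ _))// lerDl.
    by rewrite (le_trans (gC _ _))// lerDr.
  have aeF := ae_filter_ringOfSetsType mu.
  apply: filterS3 fle (gf v) (gf w) => t fle gv gw /=.
  rewrite in_itv/= => /andP[at_ tb]; have tT : 0 <= t <= T.
    by rewrite (le_trans a0 (ltW at_)) (le_trans tb bT).
  rewrite big_sumType/=.
  have tI : `[0, T]%classic t by rewrite /= in_itv.
  apply: le_trans (fle tT); apply: lerD; apply: ler_sum => j _.
    by rewrite gv.
  by rewrite gw.
- move=> v; have aeF := ae_filter_ringOfSetsType mu.
  have dg : {ae mu, forall t : R, forall j, 0 < t -> is_derive t 1
      (fun s => \int[mu]_(u in `[0, s]) g (v, j) u : R) (g (v, j) t)}.
    apply: ae_forall_countable => j.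
    exact: Rintegral_prim_derive (mg _) (gC _).
  apply: filterS2 dg (gf v) => t dg gv /andP[t0 tT] j.
  rewrite -gv; last by rewrite /= in_itv/= tT ltW.
  rewrite (_ : (fun s => _) = fun s => \int[mu]_(u in `[0, s]) g (v, j) u : R).
    exact: dg.
  by apply/funext => s; rewrite mxE.
Qed.

End Primitive.

(** * A solution along which Psi does not exceed its initial value *)

Section Derivatives.
Context {R : realType}.

(** The quotient-free form of the derivative, in which [h = 0] is harmless, matches the increment
    estimates of the Euler limit. *)
Lemma is_derive_dist_leP (W : normedModType R) (y : R -> W) (t : R) (l : W) :
  is_derive t 1 y l <->
  (forall e : R, 0 < e -> exists2 d : R, 0 < d &
    forall h, `|h| < d -> `|y (t + h) - y t - h *: l| <= e * `|h|).
Proof.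
split=> [[dy yl] e e0|yP].
  have : h^-1 *: (y (h + t) - y t) @[h --> 0^'] --> l.
    rewrite -yl; have := dy; rewrite /derivable /derive /=.
    by under eq_fun do rewrite [_ *: 1]mulr1.
  move=> /cvgrPdist_le/(_ _ e0)[d /= d0 dP]; exists d => // h hd.
  have [->|h0] := eqVneq h 0.
    by rewrite addr0 subrr sub0r scale0r oppr0 !normr0 mulr0.
  have := dP h; rewrite /ball_ /= sub0r normrN => /(_ hd h0).
  rewrite -(ler_pM2r (_ : 0 < `|h|)) ?normr_gt0//.
  rewrite mulrC -normrZ; apply: le_trans.
  by rewrite scalerBr scalerA divff// scale1r distrC [t + h]addrC.
have cvl : h^-1 *: (y (h *: 1 + t) - y t) @[h --> 0^'] --> l.
  apply/cvgrPdist_le => e e0; have [d d0 dP] := yP e e0.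
  exists d => //= h; rewrite /ball_ /= sub0r normrN => hd h0.
  have := dP h hd; rewrite -(ler_pM2r (_ : 0 < `|h|^-1)) ?invr_gt0 ?normr_gt0//.
  rewrite mulfK ?normr_eq0// mulrC -normfV -normrZ; apply: le_trans.
  rewrite [in leRHS]scalerBr scalerA mulVf// scale1r distrC.
  by rewrite [h *: 1]mulr1 [t + h]addrC.
split; first by apply/cvg_ex; exists l.
exact/cvg_lim.
Qed.

Lemma is_derive_row (n : nat) (y : R -> 'rV[R]_n) (t : R) (l : 'rV[R]_n) :
  (forall j, is_derive t 1 (fun s => y s 0 j) (l 0 j)) -> is_derive t 1 y l.
Proof.
move=> dy; have dyt : derivable y t 1.
  by apply/derivable_mxP => i j; rewrite (ord1 i); have [] := dy j.
split => //; rewrite derive_mx//; apply/rowP => j; rewrite mxE.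
by have [] := dy j.
Qed.

Lemma lipschitz_abs_continuous (n : nat) (y : R -> 'rV[R]_n) (a b L : R) :
  0 <= L ->
  (forall s t, a <= s -> s <= t -> t <= b -> `|y t - y s| <= L * (t - s)) ->
  abs_continuous a b y.
Proof.
move=> L0 yL e e0; have K0 : 0 < n.+1%:R * (L + 1) :> R.
  by rewrite mulr_gt0// ltr_wpDl.
exists (e / (n.+1%:R * (L + 1))); first by rewrite divr_gt0.
move=> m s t st _; rewrite ltr_pdivlMr//; apply: le_lt_trans.
rewrite big_distrl /=; apply: ler_sum => i _.
have [ai [si ti]] := st i.
apply: (le_trans (enorm_le_normr _)).
rewrite [leRHS]mulrCA ler_wpM2l// mulrC.
apply: (le_trans (yL _ _ ai si ti)).
by rewrite ler_wpM2r ?subr_ge0// lerDl.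
Qed.

(** Countability and density of rational vectors let one null set of times serve for frozen points
    arbitrarily near any given one. *)
Lemma rational_approx (n : nat) (v : 'rV[R]_n) (d : R) : 0 < d ->
  exists q : 'rV[rat]_n, `|map_mx ratr q - v| <= d.
Proof.
move=> d0.
have /choice[q qP] (j : 'I_n) : exists q : rat, `|ratr q - v 0 j| <= d.
  have [|q] := @rat_in_itvoo R (v 0 j - d) (v 0 j + d); first by lra.
  rewrite in_itv/= => /andP[h1 h2]; exists q; rewrite ler_norml; lra.
exists (\row_j q j); apply: normr_row_le => [|j]; first exact: ltW.
by rewrite !mxE.
Qed.

Lemma modulus_small (w : R -> R) (e : R) : modulus w -> 0 < e ->
  exists2 d : R, 0 < d & forall s, 0 <= s -> s <= d -> w s <= e.
Proof.
move=> [w0 wmono wc w00] e0.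
have /cvgrPdist_le/(_ e e0) :
    w t @[t --> within [set r : R | 0 <= r] (nbhs (0 : R))] --> w 0.
  have := wc 0; rewrite /continuous_at /= /nbhs /= -nbhs_subspace_in//=.
move=> /nbhs_normP[d /= d0 dP]; exists (d / 2); first by rewrite divr_gt0.
move=> s s0 sd; have := dP s; rewrite /= sub0r normrN ger0_norm// => /(_ _ s0).
rewrite w00 sub0r normrN => H; rewrite (le_trans (ler_norm _))// H//; lra.
Qed.

End Derivatives.

Section LocalInvariance.
Context {R : realType} {n : nat}.
Local Notation mu := (@lebesgue_measure R).

Lemma dot_delta (j : 'I_n) (x : 'rV[R]_n) : dot (delta_mx 0 j) x = x 0 j.
Proof.
rewrite /dot (bigD1 j)//= mxE !eqxx mul1r big1 ?addr0// => i ij.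
by rewrite mxE (negbTE ij) andbF mul0r.
Qed.

Lemma dot0l (x : 'rV[R]_n) : dot 0 x = 0.
Proof. by rewrite -(scale0r 0) dotZl mul0r. Qed.

Lemma equi_modulus (T : R) (f : R -> 'rV[R]_n -> 'rV[R]_n) (rho e : R) :
  classC T f -> 0 < e -> exists2 d : R, 0 < d & forall t v w, 0 <= t <= T ->
    `|v| <= rho -> `|w| <= rho -> `|v - w| <= d -> `|f t v - f t w| <= e.
Proof.
move=> [_ /(_ _ (@compact_normr_le R n rho))[om om_mod fom] _] e0.
have [d d0 omd] := modulus_small om_mod e0.
exists (d / n.+1%:R) => [|t v w tT vrho wrho vw]; first by rewrite divr_gt0.
rewrite (le_trans (normr_le_enorm _))// (le_trans (fom t v w tT vrho wrho))//.
apply: omd; first exact: enorm_ge0.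
apply: (le_trans (enorm_le_normr _)); move: vw.
by rewrite ler_pdivlMr// mulrC.
Qed.

(** The proximal Euler construction is applied to the primitive of [f]. What remains is to recover
    the differential equation for the limit at almost every time. *)
Lemma ivp_solution_le (F : 'rV[R]_n -> set 'rV[R]_n) (Psi : 'rV[R]_n -> R)
    (U : set 'rV[R]_n) (T : R) (xbar : 'rV[R]_n)
    (f : R -> 'rV[R]_n -> 'rV[R]_n) :
  lower_semicontinuous (fun x => (Psi x)%:E) -> open U -> U xbar ->
  (forall x, U x -> hamiltonian_le0 F x (prox_subdiff Psi x)) ->
  0 < T -> classCF F T xbar f ->
  exists delta : R, 0 < delta /\ exists2 y, ivp_solution f T xbar y &
    forall t, 0 <= t <= T -> t < delta -> Psi (y t) <= Psi xbar.
Proof.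
move=> Psi_lsc U_open Ux HF T0 [fC [gamma gamma0 fcone]].
have [G [Gle Gder]] := classC_primitive fC.
have Gnorm v w (c a b : R) : 0 <= c ->
    {ae mu, forall t, 0 <= t <= T -> `|f t v - f t w| <= c} ->
    0 <= a -> a <= b -> b <= T ->
    `|(G v b - G v a) - (G w b - G w a)| <= c * (b - a).
  move=> c0 fc a0 ab bT; apply: normr_row_le => [|j].
    by rewrite mulr_ge0// subr_ge0.
  (* Testing with both signs of a basis vector turns the one-sided inequality [Gle] into a bound on
     the absolute value of each coordinate. *)
  have H s : `|s| = 1 -> {ae mu, forall t, 0 <= t <= T ->
      dot (s *: delta_mx 0 j) (f t v) + dot (- s *: delta_mx 0 j) (f t w) <= c}.
    move=> s1; apply: filterS fc; first exact: (ae_filter_ringOfSetsType mu).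
    move=> t fc tT; rewrite !dotZl !dot_delta mulNr -mulrBr.
    rewrite (le_trans (ler_norm _))// normrM s1 mul1r.
    apply: le_trans (fc tT); have := normr_coord_le (f t v - f t w) j.
    by rewrite !mxE.
  have := Gle v w _ _ c a b (H 1 (normr1 _)) a0 ab bT.
  have := Gle v w _ _ c a b (H (-1) (normrN1 _)) a0 ab bT.
  rewrite !dotZl !dot_delta !mxE ler_norml; lra.
have Gnorm0 v (c a b : R) : 0 <= c ->
    {ae mu, forall t, 0 <= t <= T -> `|f t v| <= c} ->
    0 <= a -> a <= b -> b <= T -> `|G v b - G v a| <= c * (b - a).
  move=> c0 fc a0 ab bT; apply: normr_row_le => [|j].
    by rewrite mulr_ge0// subr_ge0.
  have H s : `|s| = 1 -> {ae mu, forall t, 0 <= t <= T ->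
      dot (s *: delta_mx 0 j) (f t v) + dot 0 (f t v) <= c}.
    move=> s1; apply: filterS fc; first exact: (ae_filter_ringOfSetsType mu).
    move=> t fc tT; rewrite dotZl dot_delta dot0l addr0.
    rewrite (le_trans (ler_norm _))// normrM s1 mul1r.
    by apply: le_trans (fc tT); exact: normr_coord_le.
  have := Gle v v _ _ c a b (H 1 (normr1 _)) a0 ab bT.
  have := Gle v v _ _ c a b (H (-1) (normrN1 _)) a0 ab bT.
  rewrite !dotZl !dot_delta !dot0l !mxE ler_norml; lra.
have [_ _ [c1 [c2 [c10 c20 fgrowth]]]] := fC.
have c2n0 : 0 <= c2 * n.+1%:R by rewrite mulr_ge0// ltW.
have G_growth v (a b : R) : 0 <= a -> a <= b -> b <= T ->
    `|G v b - G v a| <= (c1 + c2 * n.+1%:R * `|v|) * (b - a).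
  apply: Gnorm0; first by rewrite addr_ge0 ?mulr_ge0// ltW.
  apply: aeW => t tT; rewrite (le_trans (normr_le_enorm _))//.
  rewrite (le_trans (fgrowth t v tT))// lerD2l -mulrA ler_wpM2l ?(ltW c20)//.
  exact: enorm_le_normr.
have G_equi (rho e : R) : 0 < e -> exists2 d : R, 0 < d &
    forall v w (a b : R), `|v| <= rho -> `|w| <= rho -> `|v - w| <= d ->
    0 <= a -> a <= b -> b <= T ->
    `|(G v b - G v a) - (G w b - G w a)| <= e * (b - a).
  move=> e0; have [d d0 fd] := equi_modulus rho fC e0.
  exists d => // v w a b vrho wrho vw; apply: Gnorm; first exact: ltW.
  by apply: aeW => t tT; exact: fd.
have : nbhs xbar U by exact: open_nbhs_nbhs.
move=> /nbhs_normP[eps /= eps0 epsU].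
pose r := Num.min gamma (eps / 2).
have r0 : 0 < r by rewrite lt_min gamma0 divr_gt0.
have rU y : eball xbar r y -> U y /\ eball xbar gamma y.
  rewrite /eball /= le_min => /andP[yg ye]; split => //; apply: epsU => /=.
  rewrite distrC (le_lt_trans (normr_le_enorm _))// (le_lt_trans ye)//; lra.
have G_decr y zeta (a b : R) : eball xbar r y -> prox_subdiff Psi y zeta ->
    0 <= a -> a <= b -> b <= T -> dot zeta (G y b - G y a) <= 0.
  move=> /rU[Uy yg] zy a0 ab bT.
  have := Gle y y zeta 0 0 a b _ a0 ab bT; rewrite dot0l addr0 mul0r; apply.
  apply: filterS fcone; first exact: (ae_filter_ringOfSetsType mu).
  (* The value [f t y] is a nonnegative multiple of some [u] in [F y], and the Hamiltonian condition
     gives [dot u zeta <= 0]. *)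
  move=> t fcone tT; have [eta /= eta0 [u Fu <-]] := fcone tT y yg.
  rewrite dot0l addr0 dotC dotZl mulr_ge0_le0// -lee_fin.
  apply: le_trans (HF y Uy zeta zy); apply: ereal_sup_ubound.
  by exists u.
have [delta [rho [L [y [[delta0 rho0 L0] y0 yrho ylip yG]]]]] :=
  prox_euler_limit Psi_lsc r0 T0 (ltW c10) c2n0 G_growth G_equi G_decr.
exists delta; split => //; exists y; last first.
  by move=> t tT; have [] := yrho t tT.
split => //; first exact: (lipschitz_abs_continuous L0).
have aeF := ae_filter_ringOfSetsType mu.
(* The null set where [G v] fails to have derivative [f t v] depends on [v]. Rational [v] share one
   such set, and [y t] is approximated by a rational point [w]. *)
have Gq : {ae mu, forall t : R, forall q : 'rV[rat]_n, 0 < t <= T ->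
    forall j, is_derive t 1 (fun s => G (map_mx ratr q) s 0 j)
      (f t (map_mx ratr q) 0 j)}.
  by apply: ae_forall_countable => q; exact: Gder.
have ne0 : {ae mu, forall t : R, t != 0 /\ t != T}.
  exists [set 0; T]; split => //.
  - by apply: measurableU; exact: measurable_set1.
  - rewrite -(negligibleP _).
      apply: negligibleU; apply/negligibleP => //; exact: lebesgue_measure_set1.
    by apply: measurableU; exact: measurable_set1.
  - move=> t /= nt; have [->|t0] := eqVneq t 0; first by left.
    by have [->|tT] := eqVneq t T; [right|exfalso; apply: nt].
apply: filterS2 Gq ne0 => t Gq [tn0 tnT] /andP[t0 tT].
have {tn0}t0' : 0 < t by rewrite lt_neqAle eq_sym tn0.
have {tnT}tT' : t < T by rewrite lt_neqAle tnT.
have t0T : 0 <= t <= T by rewrite t0 tT.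
apply/is_derive_dist_leP => e e0; have e40 : 0 < e / 4 by rewrite divr_gt0.
(* Four errors of [e / 4 * |h|] are allotted: [y] against [G (y t)], [G (y t)] against [G w], [G w]
   against its derivative, and [f t w] against [f t (y t)]. The radius [rho + 1] leaves room for
   [w], which is within 1 of [y t]. *)
have [d1 d10 Gd1] := G_equi (rho + 1) _ e40.
have [d2 d20 fd2] := equi_modulus (rho + 1) fC e40.
have d0 : 0 < Num.min 1 (Num.min d1 d2) by rewrite !lt_min ltr01 d10.
have [q] := rational_approx (y t) d0.
set w := map_mx ratr q; rewrite !le_min => /andP[wy1 /andP[wyd1 wyd2]].
have yt : `|y t| <= rho + 1 by have [h1 _] := yrho t t0T; lra.
have wrho : `|w| <= rho + 1.
  rewrite -(subrK (y t) w) (le_trans (ler_normD _ _))//.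
  by have [h1 _] := yrho t t0T; lra.
have dGw : is_derive t 1 (G w) (f t w).
  by apply: is_derive_row => j; apply: Gq; rewrite t0' tT.
have [d3 d30 Gd3] := (is_derive_dist_leP _ _ _).1 dGw _ e40.
have [d4 d40 yd4] := yG _ e40.
exists (Num.min (Num.min t (T - t)) (Num.min d3 d4)).
  by rewrite !lt_min t0' d30 d40 subr_gt0 tT'.
move=> h; rewrite !lt_min => /andP[/andP[ht hT] /andP[hd3 hd4]].
have hle := ler_norm h; have hge : - h <= `|h| by rewrite -normrN ler_norm.
have th0 : 0 <= t + h by lra.
have thT : t + h <= T by lra.
have fwy : `|f t w - f t (y t)| <= e / 4 by apply: fd2.
have B1 : `|y (t + h) - y t - (G (y t) (t + h) - G (y t) t)| <= e / 4 * `|h|.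
  have [h0|h0] := leP 0 h.
    have htt : `|h| = (t + h) - t by rewrite ger0_norm// addrAC subrr add0r.
    by rewrite htt; apply: yd4; rewrite ?lerDl -?htt ?(ltW hd4).
  have -> : y (t + h) - y t - (G (y t) (t + h) - G (y t) t) =
      - (y t - y (t + h) - (G (y t) t - G (y t) (t + h))).
    by apply/rowP => j; rewrite !mxE; ring.
  have htt : `|h| = t - (t + h) by rewrite ltr0_norm// opprD addrA subrr add0r.
  by rewrite normrN htt; apply: yd4; rewrite ?gerDl -?htt ?(ltW hd4) ?(ltW h0).
have B2 : `|G w (t + h) - G w t - (G (y t) (t + h) - G (y t) t)| <=
    e / 4 * `|h|.
  have [h0|h0] := leP 0 h.
    have htt : `|h| = (t + h) - t by rewrite ger0_norm// addrAC subrr add0r.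
    by rewrite htt; apply: Gd1; rewrite ?lerDl.
  have -> : G w (t + h) - G w t - (G (y t) (t + h) - G (y t) t) =
      - (G w t - G w (t + h) - (G (y t) t - G (y t) (t + h))).
    by apply/rowP => j; rewrite !mxE; ring.
  have htt : `|h| = t - (t + h) by rewrite ltr0_norm// opprD addrA subrr add0r.
  by rewrite normrN htt; apply: Gd1; rewrite ?gerDl ?(ltW h0).
have B3 := Gd3 h hd3.
have B4 : `|h *: (f t w - f t (y t))| <= e / 4 * `|h|.
  by rewrite normrZ mulrC ler_wpM2r.
have -> : y (t + h) - y t - h *: f t (y t) =
    (y (t + h) - y t - (G (y t) (t + h) - G (y t) t))
    - (G w (t + h) - G w t - (G (y t) (t + h) - G (y t) t))
    + (G w (t + h) - G w t - h *: f t w) + h *: (f t w - f t (y t)).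
  by apply/rowP => j; rewrite !mxE; ring.
rewrite (le_trans (ler_normD _ _))//.
rewrite (le_trans (lerD (ler_normD _ _) (lexx _)))//.
rewrite (le_trans (lerD (lerD (ler_normB _ _) (lexx _)) (lexx _)))//.
lra.
Qed.

End LocalInvariance.

(** * Strong invariance *)

Section Translation.
Context {R : realType}.
Local Notation mu := (@lebesgue_measure R).

Lemma measurable_shift (c : R) :
  measurable_fun [set: measurableTypeR R]
    (fun x : R => c + x : measurableTypeR R).
Proof. by apply: measurable_funD => //; exact: measurable_cst. Qed.

(** The image of the measure under translation has the same value on half-open intervals, which
    determine Lebesgue measure. *)
Lemma lebesgue_measure_shift (c : R) (A : set R) : measurable A ->
  mu ((fun x => c + x) @^-1` A) = mu A.
Proof.
move=> mA.
rewrite -[LHS]/(pushforward mu (fun x : R => c + x : measurableTypeR R) A).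
apply/esym/lebesgue_measure_unique => //=; first exact: measurable_shift.
move=> _ _ [[a b]] _ <-.
rewrite /pushforward (_ : _ @^-1` _ = `]a - c, b - c]%classic).
  rewrite !lebesgue_measure_itv/= !lte_fin ltrD2r -!EFinB.
  by rewrite opprB addrA subrK.
by apply/seteqP; split => x /=; rewrite !in_itv/= ltrBlDl lerBrDl.
Qed.

Lemma ae_shift (c : R) (P : R -> Prop) :
  {ae mu, forall t, P t} -> {ae mu, forall s, P (c + s)}.
Proof.
move=> [M [mM M0 PM]]; exists ((fun x => c + x) @^-1` M); split.
- by rewrite -[_ @^-1` _]setTI; exact: measurable_shift.
- by rewrite lebesgue_measure_shift.
- by move=> s Ps; apply: PM.
Qed.

End Translation.

Section Invariance.
Context {R : realType} {n : nat}.

Lemma abs_continuous_shift (c a b : R) (phi : R -> 'rV[R]_n) :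
  abs_continuous (c + a) (c + b) phi ->
  abs_continuous a b (fun s => phi (c + s)).
Proof.
move=> ac e e0; have [d d0 dP] := ac e e0; exists d => // m s t st stij std.
apply: (dP m (fun i => c + s i) (fun i => c + t i)).
- by move=> i; rewrite !lerD2l.
- by move=> i j ij; rewrite !lerD2l; exact: stij.
- rewrite (eq_bigr (fun i => t i - s i))// => i _.
  by rewrite opprD addrACA subrr add0r.
Qed.

Lemma abs_continuous_dist (a b : R) (phi : R -> 'rV[R]_n) :
  abs_continuous a b phi -> forall e, 0 < e -> exists2 d, 0 < d &
    forall s t, a <= s -> s <= t -> t <= b -> t - s < d -> `|phi t - phi s| < e.
Proof.
move=> ac e e0; have [d d0 dP] := ac e e0; exists d => // s t a_s st tb std.
have := dP 1%N (fun=> s) (fun=> t); rewrite !big_ord1 => H.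
apply: le_lt_trans (normr_le_enorm _) _; apply: H => //.
by move=> i j; rewrite !ord1 eqxx.
Qed.

(** Continuous induction: the left-limit condition gives [P] at the supremum of the initial segments
    where [P] holds, and the right-extension condition passes beyond it unless it is [b]. *)
Lemma real_induction (P : R -> Prop) (b : R) : 0 <= b -> P 0 ->
  (forall t, 0 < t -> t <= b ->
    (forall e, 0 < e -> exists s, [/\ 0 <= s, s <= t, t - s < e & P s]) ->
    P t) ->
  (forall t, 0 <= t -> t < b -> P t -> exists2 d, 0 < d &
    forall s, t <= s -> s < t + d -> s <= b -> P s) ->
  P b.
Proof.
move=> b0 P0 Pclosed Popen.
pose A := [set t | 0 <= t <= b /\ forall s, 0 <= s <= t -> P s].
have A0 : A 0.
  split; first by rewrite lexx.
  by move=> s /le_anti <-.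
have supA : has_sup A.
  by split; [exists 0|exists b => t [/andP[_ tb] _]].
have s0 : 0 <= sup A by apply: sup_upper_bound.
have sb : sup A <= b by apply: sup_le_ub; [exists 0|move=> t [/andP[_ tb] _]].
have Plt s : 0 <= s -> s < sup A -> P s.
  move=> s00 /(sup_gt (ex_intro _ 0 A0))[t [_ tP] st].
  by apply: tP; rewrite s00 ltW.
have Psup : P (sup A).
  have [sA0|sA0] := eqVneq (sup A) 0; first by rewrite sA0.
  have {}s0 : 0 < sup A by rewrite lt_neqAle eq_sym sA0.
  apply: Pclosed => // e e0.
  exists (Num.max 0 (sup A - e / 2)); split.
  - by rewrite le_max lexx.
  - by rewrite ge_max (ltW s0)/=; lra.
  - rewrite ltrBlDr -ltrBlDl lt_max; apply/orP; right; lra.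
  - by apply: Plt; [rewrite le_max lexx|rewrite gt_max s0/=; lra].
have [->//|sneb] := eqVneq b (sup A).
have {}sb : sup A < b by rewrite lt_neqAle eq_sym sneb.
have [d d0 dP] := Popen _ s0 sb Psup.
pose s1 := Num.min b (sup A + d / 2).
have s1A : A s1.
  split.
    by rewrite /s1 ge_min lexx/= le_min b0/=; lra.
  move=> s /andP[s00]; rewrite le_min => /andP[sb' sd].
  have [slt|sge] := ltP s (sup A); first exact: Plt.
  apply: dP => //; lra.
have : s1 <= sup A by apply: sup_upper_bound.
by rewrite /s1 ge_min => /orP[]; lra.
Qed.

End Invariance.

Lemma is_derive_shift (R : realType) (n : nat) (c u : R) (x : R -> 'rV[R]_n) v :
  is_derive (c + u) 1 x v -> is_derive u 1 (fun s => x (c + s)) v.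
Proof.
move=> /is_derive_dist_leP dx; apply/is_derive_dist_leP => e /dx[d d0 dP].
by exists d => // h /dP; rewrite addrA.
Qed.

Theorem theorem2 (R : realType) (n : nat)
    (F : 'rV[R]_n -> set 'rV[R]_n) (Psi : 'rV[R]_n -> R)
    (FU : conditionU F)
    (Psi_lsc : lower_semicontinuous (fun x => (Psi x)%:E))
    (U : set 'rV[R]_n) (U_open : open U)
    (S_sub_U : [set x | Psi x <= 0] `<=` U)
    (HF : forall x, U x -> hamiltonian_le0 F x (prox_subdiff Psi x)) :
  strongly_invariant F [set x | Psi x <= 0].
Proof.
move=> x0 /= Psi0 Tx x [_ x_ac xx0 x_traj _] t t0 tT.
apply: (@real_induction _ (fun s => Psi (x s) <= 0)) => //.
- by rewrite xx0.
(* The set where [Psi] is positive is open and [x] is continuous, so a positive value at [s] would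
   persist just before [s]. *)
- move=> s s0 st s_lim; rewrite leNgt; apply/negP => Psi_gt.
  have : nbhs (x s) [set z | 0 < Psi z].
    by apply: open_nbhs_nbhs; split => //; exact: lsc_open_gt.
  move=> /nbhs_normP[e /= e0 eP].
  have [d d0 dP] := abs_continuous_dist (x_ac 0 t (lexx 0) t0 tT) e0.
  have [s' [s'0 s's ss' Ps']] := s_lim d d0.
  have := eP (x s') (dP s' s s'0 s's st ss').
  by rewrite /= ltNge Ps'.
(* The trajectory is restarted at time [s]. By uniqueness, the solution of the initial value problem
   along which [Psi] stays at most [Psi (x s)] is the restarted trajectory itself. *)
- move=> s s0 st Ps; have T'0 : 0 < t - s by rewrite subr_gt0.
  have phi_traj : Traj F (t - s) (x s) (fun u => x (s + u)).
    split; last first.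
    + have := ae_shift s x_traj; apply: filterS.
        exact: (ae_filter_ringOfSetsType lebesgue_measure).
      move=> u xu /andP[u0 uT].
      have [|v Fv dv] := xu (addr_ge0 s0 u0).
        by apply: le_lt_trans tT; rewrite lee_fin -lerBrDl.
      by exists v => //; exact: is_derive_shift.
    + by rewrite addr0.
    + apply: abs_continuous_shift; apply: x_ac; rewrite ?addr0//.
      * by rewrite addrC subrK ltW.
      * by rewrite addrC subrK.
  have [f fCF [_ f_uniq]] := FU (x s) (t - s) (ltW T'0) _ phi_traj.
  have [d [d0 [y y_sol yP]]] :=
    ivp_solution_le Psi_lsc U_open (S_sub_U _ Ps) HF T'0 fCF.
  exists d => // r sr rd rt.
  have rsT : 0 <= r - s <= t - s by rewrite subr_ge0 sr lerD2r.
  have := f_uniq y y_sol (r - s) rsT; rewrite [s + _]addrC subrK => <-.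
  by apply: le_trans Ps; apply: yP => //; rewrite ltrBlDl.
Qed.
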